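(* Let $d\ge 3$. There exist constants $c,C>0$, depending only on $d$, such that $$c\,\Lambda_{k,l}^{-1/2}\le\lambda_{k,l}\le C\,\Lambda_{k,l}^{-1/2}\quad\text{for all }k,l\in\mathbb{N}=\{0,1,2,\dots\},$$ where $$\Lambda_{k,l}=4k+2l+d+l(l+d-2)=4k+l^2+dl+d$$ and $$\lambda_{k,l}=\sqrt{\pi}\int_{\mathbb{S}^{d-1}}(1-v_1^2)^k(1-v_1^2+iv_1v_2)^l\,d\mathbb{S}^{d-1}(v).$$
   Context: Here $v=(v_1,v_2,\dots,v_d)$ are the standard coordinates on the unit sphere $\mathbb{S}^{d-1}\subset\mathbb{R}^d$ and $d\mathbb{S}^{d-1}$ is the standard surface measure. The integral defining $\lambda_{k,l}$ is real by the symmetry $v_2\mapsto -v_2$. (The $\lambda_{k,l}$ are the eigenvalues of the Gaussian-weighted normal operator $N=e^{-\rho^2/2}I_0^\sharp e^{|p|^2}I_0e^{-\rho^2/2}$ of the X-ray transform on $\mathbb{R}^d$, where $I_0f(v,p)=\int_{\mathbb{R}}f(p+tv)\,dt$ for $(v,p)\in\mathbb{S}^{d-1}\times\mathbb{R}^d$ with $v\cdot p=0$, $I_0^\sharp g(z)=\int_{\mathbb{S}^{d-1}}g(v,z-(z\cdot v)v)\,dv$, and $\rho=|z|$; the eigenvalue $\lambda_{k,l}$ is attained on the functions $e^{-\rho^2/2}L_k^{(l+d/2-1)}(\rho^2)\rho^lY_l(\omega)$ with $L_k^{(\alpha)}$ generalized Laguerre polynomials and $Y_l$ spherical harmonics of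 degree $l$.) *)

(* Defs.v *)
From HB Require Import structures.
From mathcomp Require Import all_boot all_order all_algebra.
From mathcomp Require Import complex ring.
From mathcomp Require Import all_classical all_reals all_analysis.
From mathcomp Require Import measurable_realfun.

Set Implicit Arguments.
Unset Strict Implicit.
Unset Printing Implicit Defensive.

Import Order.TTheory GRing.Theory Num.Theory.
Import numFieldNormedType.Exports.

Local Open Scope classical_set_scope.
Local Open Scope ring_scope.
Local Open Scope complex_scope.

(* The carrier is [measurableTypeR R], not [R], because that is the measurable
   type on which the library's [lebesgue_measure] lives. *)
Notation euclid R n := (n.-tuple (measurableTypeR R)).

Definition tuple_cons (T : Type) (n : nat) (p : T * n.-tuple T) : n.+1.-tuple T :=
  [tuple of p.1 :: p.2].

Lemma measurable_tuple_cons d (T : measurableType d) (n : nat) :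
  measurable_fun [set: (T * n.-tuple T)%type] (@tuple_cons T n).
Proof. exact: measurable_cons. Qed.

(* n-dimensional Lebesgue measure, as an iterated product. *)
Fixpoint lebesgue_tuple (R : realType) (n : nat) : set (euclid R n) -> \bar R :=
  if n is m.+1 then
    pushforward (lebesgue_measure \x @lebesgue_tuple R m)%E
      (@tuple_cons (measurableTypeR R) m)
  else dirac [tuple].
Arguments lebesgue_tuple {R} n.

Section lebesgue_tuple_measure.
Variable R : realType.
Local Notation consR n := (@tuple_cons (measurableTypeR R) n).

Let ex_lebesgue_tuple n :
  exists mu : {sigma_finite_measure set (euclid R n) -> \bar R},
    (mu : set _ -> _) = lebesgue_tuple n.
Proof.
elim: n => [|n [mu muE]]; first by exists (dirac [tuple]).
have mcons := @measurable_tuple_cons _ (measurableTypeR R) n.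
pose p : {measure set (measurableTypeR R * euclid R n)%type -> \bar R} :=
  (lebesgue_measure \x mu)%E.
have nu_sigma_finite : sigma_finite setT (pushforward p (consR n)).
  have [F [TF ndF Foo]] :=
    (sigma_finiteP setT (@lebesgue_measure R)).1 (sigma_finiteT _).
  have [G [TG ndG Goo]] := (sigma_finiteP setT mu).1 (sigma_finiteT mu).
  exists (fun i => [set x | F i (thead x) /\ G i [tuple of behead x]]).
    apply/seteqP; split=> // x _.
    have [i _ Fi] : (\bigcup_i F i) (thead x) by rewrite -TF.
    have [j _ Gj] : (\bigcup_i G i) [tuple of behead x] by rewrite -TG.
    exists (maxn i j) => //; split.
      by move: (thead x) Fi; exact/subsetPset/ndF/leq_maxl.
    by move: [tuple of behead x] Gj; exact/subsetPset/ndG/leq_maxr.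
  move=> i; have [mF Fi] := Foo i; have [mG Gi] := Goo i; split.
    apply: measurableI; rewrite -[X in measurable X]setTI.
      exact: (measurable_tnth ord0).
    exact: measurable_behead.
  rewrite /pushforward (_ : _ @^-1` _ = F i `*` G i); last first.
    apply/seteqP; split=> -[a x] /=; rewrite theadE (_ : [tuple of _] = x)//;
      exact/val_inj.
  have -> : p (F i `*` G i) = (lebesgue_measure (F i) * mu (G i))%E.
    exact: product_measure1E.
  by rewrite lte_mul_pinfty// ge0_fin_numE.
pose nu : {measure set (euclid R n.+1) -> \bar R} :=
  measure_function_pushforward__canonical__measure_function_Measure p mcons.
exists (HB.pack_for {sigma_finite_measure set (euclid R n.+1) -> \bar R}
  (Measure.sort nu)
  (Measure_isSigmaFinite.Build _ _ _ (Measure.sort nu) nu_sigma_finite)).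
by rewrite /= -muE.
Qed.

Let lebesgue_tuple0 n : lebesgue_tuple n set0 = 0%E :> \bar R.
Proof. by have [mu <-] := ex_lebesgue_tuple n. Qed.

Let lebesgue_tuple_ge0 n (A : set (euclid R n)) : (0 <= lebesgue_tuple n A)%E.
Proof. by have [mu <-] := ex_lebesgue_tuple n. Qed.

Let lebesgue_tuple_sigma_additive n :
  semi_sigma_additive (lebesgue_tuple n : set (euclid R n) -> \bar R).
Proof.
have [mu <-] := ex_lebesgue_tuple n; exact: measure_semi_sigma_additive.
Qed.

HB.instance Definition _ n := isMeasure.Build _ _ _ (lebesgue_tuple n)
  (@lebesgue_tuple0 n) (@lebesgue_tuple_ge0 n) (@lebesgue_tuple_sigma_additive n).

Let lebesgue_tuple_sigma_finite n :
  sigma_finite setT (lebesgue_tuple n : set (euclid R n) -> \bar R).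
Proof. by have [mu <-] := ex_lebesgue_tuple n; exact: sigma_finiteT. Qed.

HB.instance Definition _ n := Measure_isSigmaFinite.Build _ _ _
  (lebesgue_tuple n) (@lebesgue_tuple_sigma_finite n).

End lebesgue_tuple_measure.

Definition enorm (R : realType) (n : nat) (x : euclid R n) : R :=
  Num.sqrt (\sum_(i < n) tnth x i ^+ 2).

Definition unit_sphere (R : realType) (n : nat) : set (euclid R n) :=
  [set v | enorm v = 1].
Arguments unit_sphere R n : clear implicits.

Definition normalize (R : realType) (n : nat) (x : euclid R n) : euclid R n :=
  [tuple tnth x i / enorm x | i < n].

Definition punctured_ball (R : realType) (n : nat) : set (euclid R n) :=
  [set x | 0 < enorm x <= 1].
Arguments punctured_ball R n : clear implicits.

(* The surface measure of A is n times the volume of the cone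
   {r v | 0 < r <= 1, v \in A}: it is the measure sigma on the sphere for which
   dx = r^(n-1) dr dsigma(v) in polar coordinates x = r v. *)
Definition surface_measure (R : realType) (n : nat) (A : set (euclid R n)) : \bar R :=
  (n%:R%:E * lebesgue_tuple n (@normalize R n @^-1` A `&` punctured_ball R n))%E.
Arguments surface_measure {R} n A.

Section surface_measure_measure.
Variable R : realType.

Lemma measurable_enorm n : measurable_fun [set: euclid R n] (@enorm R n).
Proof.
apply: (@measurableT_comp _ _ _ _ _ _ (@Num.sqrt R)).
  by apply: continuous_measurable_fun; exact: sqrt_continuous.
by apply: measurable_sum => i; apply: measurable_funX; exact: measurable_tnth.
Qed.

Lemma measurable_normalize n : measurable_fun [set: euclid R n] (@normalize R n).
Proof.
apply/measurable_fun_tnthP => i.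
rewrite (_ : _ \o _ = fun x => tnth x i * enorm x `^ (-1)); last first.
  by apply/funext => x /=; rewrite tnth_mktuple powR_inv1// sqrtr_ge0.
apply: measurable_funM; first exact: measurable_tnth.
apply: (measurableT_comp (measurable_powR _)); exact: measurable_enorm.
Qed.

Lemma measurable_punctured_ball n : measurable (punctured_ball R n).
Proof.
rewrite -[X in measurable X]setTI.
rewrite (_ : punctured_ball R n = @enorm R n @^-1` `]0, 1]%classic).
  exact: measurable_enorm.
by apply/seteqP; split=> x /=; rewrite in_itv.
Qed.

Let surface_measure0 n : surface_measure n set0 = 0%E :> \bar R.
Proof. by rewrite /surface_measure preimage_set0 set0I measure0 mule0. Qed.

Let surface_measure_ge0 n (A : set (euclid R n)) : (0 <= surface_measure n A)%E.
Proof. by rewrite /surface_measure mule_ge0. Qed.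

Let surface_measure_sigma_additive n :
  semi_sigma_additive (surface_measure n : set (euclid R n) -> \bar R).
Proof.
pose p : {measure set (euclid R n) -> \bar R} :=
  measure_function_pushforward__canonical__measure_function_Measure
    (mrestr (lebesgue_tuple n) (@measurable_punctured_ball n))
    (@measurable_normalize n).
exact: (@measure_semi_sigma_additive _ _ _ (mscale (NngNum (ler0n R n)) p)).
Qed.

HB.instance Definition _ n := isMeasure.Build _ _ _ (surface_measure n)
  (@surface_measure0 n) (@surface_measure_ge0 n)
  (@surface_measure_sigma_additive n).

End surface_measure_measure.

Definition Cintegral d (T : measurableType d) (R : realType)
    (mu : {measure set T -> \bar R}) (D : set T) (f : T -> R[i]) : R[i] :=
  (\int[mu]_(x in D) complex.Re (f x)) +i* (\int[mu]_(x in D) complex.Im (f x)).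

(* Coordinates are numbered from 0: v_1 and v_2 are [v`_0] and [v`_1]. *)
Definition lambda (R : realType) (d k l : nat) : R[i] :=
  (Num.sqrt pi)%:C * Cintegral (surface_measure d) (unit_sphere R d)
    (fun v : euclid R d =>
      (1 - (v`_0)%:C ^+ 2) ^+ k *
      (1 - (v`_0)%:C ^+ 2 + 'i * (v`_0)%:C * (v`_1)%:C) ^+ l).

Definition Lambda (R : realType) (d k l : nat) : R :=
  4 * k%:R + 2 * l%:R + d%:R + l%:R * (l%:R + d%:R - 2).

Lemma LambdaE (R : realType) (d k l : nat) :
  Lambda R d k l = 4 * k%:R + l%:R ^+ 2 + d%:R * l%:R + d%:R.
Proof. by rewrite /Lambda; ring. Qed.

(* Main.v *)
(* Put m = d - 2 and alpha = m / 2.  Integrating by parts against the density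
   (1 - x^2 - y^2)^(m/2 - 1) of the first two coordinates of a point of the
   sphere gives, for lambda_{k,l},
     (l + m) lambda_{k,l+1} = (2 l + m) lambda_{k+1,l} - l lambda_{k+1,l-1},
     (2 k + m + 2) lambda_{k+1,0} = (2 k + m + 1) lambda_{k,0},
   which determine lambda up to a factor.  The same recurrences hold for
     sum_j p_j T_j,  p_j proportional to (alpha)_j (alpha)_{l-j} / (j! (l-j)!),
     T_j = Gamma(2 N + 1) 2^(-2 N) / (Gamma(N + 1 + s) Gamma(N + 1 - s)),
   where N = k + l/2 + alpha and s = l/2 - j: this is the expansion of the
   Gegenbauer polynomial of degree l in the functions cos((l - 2 j) theta),
   integrated against cos(theta)^(2 N).  All terms are now positive.
   The weights p_j sum to 1 and T is unimodal, so by Chebyshev's sum inequality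
   the sum compares with the mean of T over 0 <= j <= l; for the Pascal-type
   array T this mean is of order min(1/(l+1), 1/sqrt(k+1)).

   The integration by parts is checked on monomials: the moments of the sphere
   are quotients of Gaussian moments, by polar coordinates. *)
Require Import Defs.
From mathcomp Require Import all_boot all_order all_algebra.
From mathcomp Require Import complex.
From mathcomp Require Import all_classical all_reals all_analysis.
From mathcomp Require Import measurable_realfun gauss_integral.
From mathcomp Require Import zify ring lra.

Set Implicit Arguments.
Unset Strict Implicit.
Unset Printing Implicit Defensive.

Import Order.TTheory GRing.Theory Num.Theory.
Import numFieldNormedType.Exports.

Local Open Scope ring_scope.

(** * Gegenbauer sums *)

(** The integrand of lambda oscillates and its recurrences contain a subtraction, so neither sign
    nor size can be carried along them. They serve only to identify lambda with the positive sum,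
    which is then estimated directly. Chebyshev's inequality yields only one of the two bounds. For
    alpha >= 1 the weights p_j increase towards the middle, as T does, and the weighted mean is at
    least the plain mean. For alpha = 1/2 they increase towards the ends and it is at most the plain
    mean. The opposite bound compares every single weight with 1/(l+1): at most a constant times it
    for alpha >= 1, at least a quarter of it for alpha = 1/2. No other case occurs, alpha being half
    of a positive integer when d >= 3. The surface measure is defined by volumes of cones, so polar
    coordinates have to be derived. On nonnegative homogeneous functions they reduce to Tonelli's
    theorem, and reflections dispose of the odd moments. *)

Section gegenbauer.
Variables (F : realFieldType) (al : F).

(* (al)_j / j!, the coefficient of t^j in (1 - t)^(- al) *)
Definition gcoef (j : nat) : F := \prod_(i < j) ((al + i%:R) / i.+1%:R).

(** The shifted coefficients, extended by 0 at [j = 0]: all terms of the three-term recurrence then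
    become sums over the same range [j <= l]. *)
Definition gcoef_pred (j : nat) : F := if j is j'.+1 then gcoef j' else 0.

Definition gconv (f g : nat -> F) (l : nat) (u : nat -> F) : F :=
  \sum_(j < l.+1) f j * g (l - j)%N * u j.

Definition gsum (l : nat) (u : nat -> F) : F := gconv gcoef gcoef l u.

Lemma gcoef0 : gcoef 0 = 1. Proof. by rewrite /gcoef big_ord0. Qed.

Lemma gcoefS j : gcoef j.+1 = gcoef j * ((al + j%:R) / j.+1%:R).
Proof. by rewrite /gcoef big_ord_recr. Qed.

Lemma gcoef_predE j : j%:R * gcoef j = (al + j%:R - 1) * gcoef_pred j.
Proof.
case: j => [|j] /=; first by rewrite mul0r mulr0.
rewrite gcoefS; field.
by rewrite nat1r pnatr_eq0.
Qed.

Lemma gconv_predl l u : gconv gcoef_pred gcoef l.+1 u = gsum l (fun j => u j.+1).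
Proof.
rewrite /gsum /gconv big_ord_recl /= !mul0r add0r.
by apply: eq_bigr => j _; rewrite /bump/= add1n.
Qed.

Lemma gconv_predr l u : gconv gcoef gcoef_pred l.+1 u = gsum l u.
Proof.
rewrite /gsum /gconv big_ord_recr /= subnn /= mulr0 mul0r addr0.
by apply: eq_bigr => j _; rewrite subSn // -ltnS.
Qed.

Lemma gconv_pred l u :
  gconv gcoef_pred gcoef_pred l.+2 u = gsum l (fun j => u j.+1).
Proof.
rewrite /gsum /gconv big_ord_recl /= !mul0r add0r big_ord_recr/=.
rewrite subnn /= mulr0 mul0r addr0.
by apply: eq_bigr => j _; rewrite /bump/= add1n subSS subSn // -ltnS.
Qed.

(* Recurrence of the Gegenbauer polynomials, where [u j] stands for
   z^(l - 2 j), with z = e^(i theta) *)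
Lemma gconv_rec l u :
  l%:R * gsum l u =
    (l%:R + al - 1) * (gconv gcoef gcoef_pred l u + gconv gcoef_pred gcoef l u)
    - (l%:R + 2 * al - 2) * gconv gcoef_pred gcoef_pred l u.
Proof.
rewrite /gsum /gconv -big_split /= !mulr_sumr -sumrB; apply: eq_bigr => j _.
have jl : (j <= l)%N by rewrite -ltnS.
rewrite -[in l%:R](subnK jl) natrD.
have := gcoef_predE j; have := gcoef_predE (l - j).
move: (gcoef j) (gcoef_pred j) (gcoef (l - j)) (gcoef_pred (l - j)) => A b B c.
move: (j%:R) ((l - j)%:R) => x y hB hA.
apply/eqP; rewrite -subr_eq0; apply/eqP.
(* The difference of the two summands is a combination of [hA] and [hB], the one-step relations for
   [j] and [l - j], so the recurrence holds term by term. *)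
have -> : (y + x) * (A * B * u j) - ((y + x + al - 1) * (A * c * u j + b * B * u j)
    - (y + x + 2 * al - 2) * (b * c * u j)) =
  ((B - c) * (x * A - (al + x - 1) * b) + (A - b) * (y * B - (al + y - 1) * c)) * u j
  by ring.
by rewrite hA hB !subrr !mulr0 addr0 mul0r.
Qed.

(* Gamma(a + b + 1) / (2^(a + b) Gamma(a + 1) Gamma(b + 1)) for a = al + i and
   b = al + j, normalised to be 1 at i = j = 0 *)
Definition tau (i j : nat) : F :=
  (\prod_(s < i + j) ((2 * al + 1 + s%:R) / 2)) /
  ((\prod_(s < i) (al + 1 + s%:R)) * (\prod_(s < j) (al + 1 + s%:R))).

Hypothesis al_gt0 : 0 < al.

Let pospart (s : nat) : 0 < al + 1 + s%:R.
Proof. by rewrite ltr_wpDr // addr_gt0. Qed.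

Let pospart0 (s : nat) : al + 1 + s%:R != 0.
Proof. by rewrite gt_eqF. Qed.

Let prod_neq0 i : \prod_(s < i) (al + 1 + s%:R) != 0.
Proof. by apply/prodf_neq0 => s _. Qed.

Lemma tau00 : tau 0 0 = 1.
Proof. by rewrite /tau !big_ord0 mulr1 divr1. Qed.

Lemma tau_gt0 i j : 0 < tau i j.
Proof.
rewrite /tau divr_gt0 ?mulr_gt0 ?prodr_gt0 // => s _.
by rewrite divr_gt0 // ltr_wpDr // addr_gt0 // mulr_gt0.
Qed.

Lemma tauC i j : tau i j = tau j i.
Proof. by rewrite /tau addnC [X in _ / X]mulrC. Qed.

Lemma tauSr i j : tau i j.+1 =
  tau i j * ((2 * al + 1 + i%:R + j%:R) / (2 * (al + 1 + j%:R))).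
Proof.
rewrite /tau addnS !big_ord_recr /= natrD.
have := pospart0 j; have := prod_neq0 i; have := prod_neq0 j.
move: (\prod_(s < j) _) (\prod_(s < i) _) (\prod_(s < i + j) _) => x y z hx hy hz.
by field; rewrite hx hy hz.
Qed.

Lemma tauSl i j : tau i.+1 j =
  tau i j * ((2 * al + 1 + i%:R + j%:R) / (2 * (al + 1 + i%:R))).
Proof. by rewrite tauC tauSr tauC [_ + j%:R + _]addrAC. Qed.

(** Up to normalisation [tau i j] is 2^(-n) times the generalised binomial coefficient of n = 2 al +
    i + j over al + i. Pascal's rule for it plays the part of multiplication by cos(theta) in the
    Gegenbauer recurrence. *)
Lemma tau_pascal i j : tau i.+1 j.+1 = (tau i j.+1 + tau i.+1 j) / 2.
Proof.
rewrite tauSl tauSr tauSl -natr1.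
have := pospart0 j; have := pospart0 i => hi hj.
by field; rewrite hi hj.
Qed.

(** The value of the Gegenbauer polynomial at theta = 0, that is, the coefficient of t^l in (1 -
    t)^(-2 al). *)
Definition gmass l := gsum l (fun=> 1).

Lemma gcoef_gt0 j : 0 < gcoef j.
Proof. by apply: prodr_gt0 => i _; rewrite divr_gt0 // ltr_wpDr. Qed.

Lemma gmass0 : gmass 0 = 1.
Proof. by rewrite /gmass /gsum /gconv big_ord_recl big_ord0 !gcoef0 !mulr1 addr0. Qed.

Lemma gmass_gt0 l : 0 < gmass l.
Proof.
rewrite /gmass /gsum /gconv big_ord_recl ltr_wpDr // ?mulr_gt0 ?gcoef_gt0 //.
by apply: sumr_ge0 => j _; rewrite mulr1 mulr_ge0 // ltW // gcoef_gt0.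
Qed.

(** At [u = 1] the recurrence has order two; by induction it preserves this first-order relation,
    which holds at [l = 0]. *)
Lemma gmassS l : l.+1%:R * gmass l.+1 = (l%:R + 2 * al) * gmass l.
Proof.
have H : forall l, l.+2%:R * gmass l.+2 = 2 * (l%:R + 1 + al) * gmass l.+1
    - (l%:R + 2 * al) * gmass l.
  move=> {}l; rewrite /gmass gconv_rec gconv_predl gconv_predr gconv_pred.
  by rewrite -(natr1 l.+1) -(natr1 l); ring.
elim: l => [|l IH].
  by rewrite gmass0 /gmass gconv_rec gconv_predl gconv_predr /gconv !big_ord_recl
    !big_ord0 /= -/(gmass 0) gmass0; ring.
by rewrite H -IH -(natr1 l); ring.
Qed.

(** With N = k + l/2 + al and s = l/2 - j, the arguments of [tau] stand for N - s and N + s. *)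
Definition gseq (k l : nat) : F :=
  gsum l (fun j => tau (k + j) (k + (l - j))) / gmass l.

Lemma gsum_ext l u v : (forall j, (j <= l)%N -> u j = v j) -> gsum l u = gsum l v.
Proof. by move=> uv; apply: eq_bigr => j _; rewrite uv // -ltnS. Qed.

Lemma gsum_add l u v : gsum l u + gsum l v = gsum l (fun j => u j + v j).
Proof. by rewrite /gsum /gconv -big_split; apply: eq_bigr => j _ /=; rewrite mulrDr. Qed.

Lemma gsum_scale c l u : gsum l (fun j => c * u j) = c * gsum l u.
Proof. by rewrite /gsum /gconv mulr_sumr; apply: eq_bigr => j _ /=; rewrite mulrCA. Qed.

(** In [gconv_rec] the two single shifts add up, by Pascal's rule, to twice the row with [k.+1], and
    the double shift is itself such a row. At [l = 0] the index [l.-1] is harmless, its coefficient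
    being 0. *)
Lemma gseqS k l : (l%:R + 2 * al) * gseq k l.+1 =
  2 * (l%:R + al) * gseq k.+1 l - l%:R * gseq k.+1 l.-1.
Proof.
pose u j := tau (k + j) (k + (l.+1 - j)).
have mid : 2 * gsum l (fun j => tau (k.+1 + j) (k.+1 + (l - j))) =
    gsum l u + gsum l (fun j => u j.+1).
  rewrite -gsum_scale gsum_add; apply: gsum_ext => j jl.
  rewrite /u !addSn tau_pascal addnS subSS subSn // addnS.
  by rewrite mulrCA mulfV ?mulr1 // pnatr_eq0.
have nz n := gt_eqF (gmass_gt0 n).
have -> : (l%:R + 2 * al) * gseq k l.+1 = l.+1%:R * gsum l.+1 u / gmass l.
  rewrite /gseq -/u -[l%:R + 2 * al](mulfK (negbT (nz l))) -gmassS.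
  by field; rewrite !nz.
rewrite gconv_rec gconv_predl gconv_predr -mid /gseq.
case: l => [|l] in u mid *.
  by rewrite /gconv !big_ord_recl big_ord0 /= gmass0; field.
rewrite gconv_pred /=.
have -> : gsum l (fun j => u j.+1) = gsum l (fun j => tau (k.+1 + j) (k.+1 + (l - j))).
  by apply: gsum_ext => j jl; rewrite /u subSS subSn // !addnS !addSn.
have := gmassS l.
move: (gsum l _) (gsum l.+1 _) (nz l) (nz l.+1) => s1 s2.
move: (gmass l) (gmass l.+1) => x y hx hy e.
have -> : l.+1%:R * (s1 / x) = (l%:R + 2 * al) * s1 / y.
  by apply/eqP; rewrite mulrA eqr_div ?hx ?hy //; apply/eqP; rewrite mulrAC e; ring.
by rewrite -(natr1 l); field; rewrite hy.
Qed.

Lemma gseq_k0 k : gseq k 0 = tau k k.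
Proof.
by rewrite /gseq /gsum /gconv big_ord_recl big_ord0 /= gcoef0 gmass0 !addn0; field.
Qed.

Lemma gseqS0 k :
  (2 * k%:R + 2 * al + 2) * gseq k.+1 0 = (2 * k%:R + 2 * al + 1) * gseq k 0.
Proof.
rewrite !gseq_k0 tauSl tauSr -natr1.
have := pospart0 k => h; by field; rewrite h.
Qed.

Lemma gseq_unique (Y : nat -> nat -> F) :
  (forall k, (2 * k%:R + 2 * al + 2) * Y k.+1 0 = (2 * k%:R + 2 * al + 1) * Y k 0) ->
  (forall k l, (l%:R + 2 * al) * Y k l.+1 =
    2 * (l%:R + al) * Y k.+1 l - l%:R * Y k.+1 l.-1) ->
  forall k l, Y k l = Y 0 0 * gseq k l.
Proof.
move=> Y0 YS k l; elim/ltn_ind: l k => -[|l] IH k.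
  elim: k => [|k IHk]; first by rewrite gseq_k0 tau00 mulr1.
  have p : 2 * k%:R + 2 * al + 2 != 0.
    by rewrite gt_eqF // ltr_wpDl // addr_ge0 // mulr_ge0 // ltW.
  by apply: (mulfI p); rewrite mulrCA gseqS0 Y0 IHk mulrCA.
have p : l%:R + 2 * al != 0 by rewrite gt_eqF // ltr_wpDl // mulr_gt0.
apply: (mulfI p); rewrite YS [RHS]mulrCA gseqS (IH l) // (IH l.-1); last by case: (l).
by ring.
Qed.

End gegenbauer.

(** * Chebyshev's sum inequality for symmetric unimodal sequences *)

Section unimodal.
Variables (F : realFieldType) (l : nat).
Implicit Types f g : nat -> F.

Definition sym_unimodal f :=
  (forall j, (j <= l)%N -> f (l - j)%N = f j) /\
  (forall j, (j.*2 < l)%N -> f j <= f j.+1).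

(** Such a sequence is a nondecreasing function of the distance to the nearer end. Two of them are
    therefore similarly ordered, though neither is monotone, and this is what Chebyshev's inequality
    asks for. *)
Lemma sym_unimodal_le f i j : sym_unimodal f -> (i <= l)%N -> (j <= l)%N ->
  (minn i (l - i) <= minn j (l - j))%N -> f i <= f j.
Proof.
move=> [fs fu] il jl.
have fmin n : (n <= l)%N -> f (minn n (l - n)) = f n.
  by move=> nl; rewrite /minn; case: ifP => // _; rewrite fs.
rewrite -(fmin i il) -(fmin j jl).
have : ((minn j (l - j)).*2 <= l)%N by rewrite /minn; case: ifP; lia.
move: (minn i _) (minn j _) => a b + /subnK abE; rewrite -abE.
elim: (b - a)%N => [//|n IH].
rewrite addSn doubleS => h; have h' : ((n + a).*2 < l)%N by lia.
exact: le_trans (IH (ltnW h')) (fu _ h').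
Qed.

Lemma double_sum_sub_mul f g :
  \sum_(i < l.+1) \sum_(j < l.+1) (f i - f j) * (g i - g j) =
  2 * (l.+1%:R * (\sum_(i < l.+1) f i * g i) -
       (\sum_(i < l.+1) f i) * (\sum_(i < l.+1) g i)).
Proof.
have -> : \sum_(i < l.+1) \sum_(j < l.+1) (f i - f j) * (g i - g j) =
  \sum_(i < l.+1) (l.+1%:R * (f i * g i) - f i * (\sum_(j < l.+1) g j)
     - g i * (\sum_(j < l.+1) f j) + \sum_(j < l.+1) f j * g j).
  apply: eq_bigr => i _.
  rewrite (eq_bigr (fun j : 'I_l.+1 =>
    f i * g i - f i * g j - g i * f j + f j * g j)); last first.
    by move=> j _; ring.
  rewrite big_split /= sumrB sumrB -!mulr_sumr big_const card_ord.
  by rewrite iter_addr_0 mulr_natl mulrnAr.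
rewrite big_split /= sumrB sumrB -!mulr_suml -mulr_sumr big_const card_ord.
by rewrite iter_addr_0 -mulr_natl; ring.
Qed.

Lemma chebyshev_sum_le f g :
  (forall i j, (i <= l)%N -> (j <= l)%N -> 0 <= (f i - f j) * (g i - g j)) ->
  (\sum_(i < l.+1) f i) * (\sum_(i < l.+1) g i) <= l.+1%:R * \sum_(i < l.+1) f i * g i.
Proof.
move=> fg; rewrite -subr_ge0 -(pmulr_rge0 _ (ltr0n F 2)) -double_sum_sub_mul.
by do 2! (apply: sumr_ge0 => ? _); apply: fg; rewrite -ltnS.
Qed.

Lemma chebyshev_unimodal f g : sym_unimodal f -> sym_unimodal g ->
  (\sum_(i < l.+1) f i) * (\sum_(i < l.+1) g i) <= l.+1%:R * \sum_(i < l.+1) f i * g i.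
Proof.
move=> fu gu; apply: chebyshev_sum_le => i j il jl.
have [ij|/ltnW ij] := leqP (minn i (l - i)) (minn j (l - j)).
  by rewrite mulr_le0 // subr_le0 sym_unimodal_le.
by rewrite mulr_ge0 // subr_ge0 sym_unimodal_le.
Qed.

End unimodal.

(** * The array [tau]: Wallis bounds, antidiagonal sums, flatness near the diagonal *)

Section tau_bounds.
Variables (F : realFieldType) (al : F).
Hypothesis al_gt0 : 0 < al.
Local Notation tau := (tau al).

Let posal (s : nat) : 0 < al + 1 + s%:R.
Proof. by rewrite ltr_wpDr // addr_gt0. Qed.

Lemma tau_diagS k : tau k.+1 k.+1 =
  tau k k * ((2 * al + 2 * k%:R + 1) / (2 * al + 2 * k%:R + 2)).
Proof.
have al0 := al_gt0.
rewrite tauSl // tauSr // -natr1; have /gt_eqF h := posal k.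
by field; rewrite h /= -mulrDr gt_eqF //; have := posal k; lra.
Qed.

(** With y = 2 al + 2 k, the inequality (y + 1)(y + 3) <= (y + 2)^2 makes the left-hand side
    nonincreasing in [k]. *)
Lemma tau_diag_le k : (2 * k%:R + 2 * al + 1) * tau k k ^+ 2 <= 2 * al + 1.
Proof.
have al0 := al_gt0.
elim: k => [|k IH]; first by rewrite tau00 expr1n mulr1; lra.
apply: le_trans IH; rewrite tau_diagS exprMn mulrCA [leRHS]mulrC.
apply: ler_wpM2l; first exact: sqr_ge0.
have k0 : 0 <= k%:R :> F by [].
have p : 0 < 2 * al + 2 * k%:R + 2  by lra.
rewrite -natr1 expr_div_n mulrA ler_pdivrMr ?exprn_gt0 //.
rewrite -subr_ge0; set e := (X in 0 <= X).
have -> : e = 2 * k%:R + 2 * al + 1 by rewrite /e; ring.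
lra.
Qed.

(** Here (y + 1)^2 >= y (y + 2) makes the right-hand side nondecreasing in [k]. *)
Lemma tau_diag_ge k : 2 * al <= (2 * k%:R + 2 * al) * tau k k ^+ 2.
Proof.
have al0 := al_gt0.
elim: k => [|k IH]; first by rewrite tau00 expr1n mulr1; lra.
apply: (le_trans IH); rewrite tau_diagS (exprMn _ (tau k k)).
rewrite [leRHS]mulrCA [leLHS]mulrC.
apply: ler_wpM2l; first exact: sqr_ge0.
have k0 : 0 <= k%:R :> F by [].
have p : 0 < 2 * al + 2 * k%:R + 2 by lra.
rewrite -natr1 expr_div_n mulrA ler_pdivlMr ?exprn_gt0 //.
rewrite -subr_ge0; set e := (X in 0 <= X).
have -> : e = 2 * k%:R + 2 * al + 2 by rewrite /e; ring.
lra.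
Qed.

Lemma tau_le_r i j : (i <= j.+1)%N -> tau i j.+1 <= tau i j.
Proof.
have al0 := al_gt0.
move=> ij; rewrite tauSr // ler_piMr ?(ltW (tau_gt0 _ _ _)) //.
have h := posal j; rewrite ler_pdivrMr ?mul1r ?mulr_gt0 //.
by have : i%:R <= j.+1%:R :> F by [rewrite ler_nat]; rewrite -(natr1 j); lra.
Qed.

Lemma tau_le_diag k a b : tau (k + a) (k + b) <= tau k k.
Proof.
wlog ab : a b / (a <= b)%N.
  by move=> H; have [/H//|/ltnW/H] := leqP a b; rewrite tauC.
apply: (@le_trans _ _ (tau (k + a) (k + a))).
  rewrite -(subnK ab); elim: (b - a)%N => [//|n IH].
  by rewrite addSn addnS (le_trans (tau_le_r _)) //; lia.
elim: a {ab} => [|a IH]; first by rewrite addn0.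
rewrite addnS (le_trans (tau_le_r _)) // tauC (le_trans (tau_le_r _)) //.
Qed.

Lemma tau_row_unimodal k l : sym_unimodal l (fun j => tau (k + j) (k + (l - j))).
Proof.
split=> j jl; first by rewrite subKn // tauC.
have [n lE] : exists n, (l = j + n.+1)%N by exists (l - j).-1; lia.
rewrite {}lE in jl *.
have nj : (j <= n)%N by lia.
have -> : (k + (j + n.+1 - j) = (k + n).+1)%N by lia.
have -> : (k + (j + n.+1 - j.+1) = k + n)%N by lia.
rewrite addnS tauSr // tauSl // ler_wpM2l ?(ltW (tau_gt0 _ _ _)) //.
have pj := posal (k + j); have pn := posal (k + n).
apply: ler_wpM2l; first by rewrite !addr_ge0 // ?mulr_ge0 // ltW.
rewrite lef_pV2 ?posrE ?mulr_gt0 // ler_wpM2l // lerD2l ler_nat; lia.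
Qed.

Definition tau_sum k l := \sum_(j < l.+1) tau (k + j) (k + (l - j)).

Lemma tau_sum0 k : tau_sum k 0 = tau k k.
Proof. by rewrite /tau_sum big_ord_recl big_ord0 !addn0 addr0. Qed.

(** Each entry of the new antidiagonal is the mean of two neighbours on the old one: inner entries
    are counted fully, the two equal end entries by half. *)
Lemma tau_sumSk k l : tau_sum k.+1 l = tau_sum k l.+1 - tau k (k + l.+1).
Proof.
pose u j := tau (k + j) (k + (l.+1 - j)).
have -> : tau_sum k.+1 l = \sum_(j < l.+1) (u j + u j.+1) / 2.
  apply: eq_bigr => j _; have jl : (j <= l)%N by rewrite -ltnS.
  by rewrite /u !addSn tau_pascal // addnS subSS subSn // addnS.
rewrite -mulr_suml big_split /=.
have e1 : \sum_(j < l.+1) u j = tau_sum k l.+1 - u l.+1.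
  by rewrite /tau_sum [in RHS]big_ord_recr addrK.
have e2 : \sum_(j < l.+1) u j.+1 = tau_sum k l.+1 - u 0.
  rewrite /tau_sum [in RHS]big_ord_recl addrC addrA addNr add0r.
  by apply: eq_bigr => j _; rewrite lift0.
rewrite e1 e2 /u subnn subn0 !addn0 [tau (k + l.+1) k]tauC. by field.
Qed.

(** Both sums run along the same antidiagonal; the left one has one more entry at each end. *)
Lemma tau_sum_widen k l : tau_sum k l.+2 = tau_sum k.+1 l + 2 * tau k (k + l.+2).
Proof.
rewrite /tau_sum big_ord_recl big_ord_recr /= !addn0 subn0 subnn addn0.
rewrite [tau (k + l.+2) k]tauC .
rewrite (_ : \sum_(i < l.+1) _ =
  \sum_(j < l.+1) tau (k.+1 + j) (k.+1 + (l - j))); first by ring.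
apply: eq_bigr => j _; have jl : (j <= l)%N by rewrite -ltnS.
by rewrite /bump leq0n; congr tau; lia.
Qed.

Lemma tau_sumSl k l :
  tau_sum k l.+1 = tau_sum k l - tau k (k + l) + 2 * tau k (k + l.+1).
Proof.
case: l => [|l].
  rewrite /tau_sum !big_ord_recl !big_ord0 /= /bump /= !addn0 ?subn0 ?subnn ?addn0.
  by rewrite [tau (k + 1) k]tauC; ring.
by rewrite tau_sum_widen tau_sumSk.
Qed.

Lemma tau_sum_le_k k l : tau_sum k.+1 l <= tau_sum k l.
Proof.
have al0 := al_gt0.
rewrite tau_sumSk tau_sumSl.
have : tau k (k + l.+1) <= tau k (k + l) by rewrite addnS tau_le_r //; lia.
lra.
Qed.

Lemma tau_sum_antitone k k' l : (k <= k')%N -> tau_sum k' l <= tau_sum k l.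
Proof.
move=> /subnK <-; elim: (k' - k)%N => [//|n IH].
exact: le_trans (tau_sum_le_k _ _) IH.
Qed.

(** Binomial rows, the case [al = 0], have sum 1. The boundary term compensates the shift by [al]:
    with it the left-hand side is nonincreasing in [l]. *)
Lemma tau_sum0_le l : tau_sum 0 l + 2 * al * tau 0 l <= 1 + 2 * al.
Proof.
elim: l => [|l IH]; first by rewrite tau_sum0 tau00 mulr1.
apply: le_trans IH; rewrite tau_sumSl !add0n tauSr //.
have t0 := tau_gt0 al_gt0 0 l; have p := posal l.
have l0 : 0 <= l%:R :> F by [].
move: (tau_sum 0 l) (tau 0 l) t0 => s t t0.
rewrite addr0 -subr_ge0.
have -> : s + 2 * al * t - (s - t + 2 * (t * ((2 * al + 1 + l%:R) / (2 * (al + 1 + l%:R)))) +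
   2 * al * (t * ((2 * al + 1 + l%:R) / (2 * (al + 1 + l%:R)))))
  = t * al * l%:R / (al + 1 + l%:R) by field; rewrite gt_eqF.
by rewrite divr_ge0 ?mulr_ge0 // ltW.
Qed.

(** This antidiagonal is the middle part of the one that starts at [k = 0]. *)
Lemma tau_sum_le k l : tau_sum k l <= 1 + 2 * al.
Proof.
suff : tau_sum k l <= tau_sum 0 (k.*2 + l).
  move=> /le_trans; apply; apply: le_trans (tau_sum0_le (k.*2 + l)).
  by rewrite lerDl mulr_ge0 // ?(ltW (tau_gt0 _ _ _)) // mulr_ge0 // ltW.
elim: k l => [//|k IH] l; rewrite (_ : k.+1.*2 + l = k.*2 + l.+2)%N; last by lia.
apply: le_trans (IH _).
by rewrite tau_sum_widen lerDl mulr_ge0 // ltW // tau_gt0.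
Qed.

(** Step [j] away from the diagonal costs at most the factor 1 - (j+1)/(2(k+1)), and the losses add
    up to l(l+1)/(4(k+1)) <= 1/4. *)
Lemma tau_off_diag_ge k l : (l * l.+1 <= k.+1)%N -> 3 / 4 * tau k k <= tau k (k + l).
Proof.
have al0 := al_gt0.
move=> lk; have k0 : 0 < k.+1%:R :> F by [].
have H j : (1 - j%:R * (j%:R + 1) / (4 * k.+1%:R)) * tau k k <= tau k (k + j).
  elim: j => [|j IH]; first by rewrite mul0r mul0r subr0 mul1r addn0.
  rewrite addnS tauSr // -(natr1 j) -(natr1 k) natrD.
  set q := (X in _ <= _ * X).
  have j0 : 0 <= j%:R :> F by []. have kk0 : 0 <= k%:R :> F by [].
  have q1 : 1 - (j%:R + 1) / (2 * (k%:R + 1)) <= q.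
    rewrite -subr_ge0 /q.
    have d1 : al + 1 + (k%:R + j%:R) != 0 by rewrite gt_eqF //; lra.
    have d2 : 1 + k%:R != 0 :> F by rewrite gt_eqF //; lra.
    have -> : (2 * al + 1 + k%:R + (k%:R + j%:R)) / (2 * (al + 1 + (k%:R + j%:R))) -
      (1 - (j%:R + 1) / (2 * (k%:R + 1))) =
      (j%:R + 1) * (al + j%:R) / (2 * (al + 1 + (k%:R + j%:R)) * (1 + k%:R)).
      by field; rewrite d1 d2.
    by rewrite divr_ge0 ?mulr_ge0 //; lra.
  have Tt := tau_le_diag k 0 j; rewrite addn0 in Tt.
  have T0 := tau_gt0 al_gt0 k (k + j).
  have e0 : 0 <= (j%:R + 1) / (2 * (k%:R + 1)) :> F by rewrite divr_ge0 //; lra.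
  have -> : (j%:R + 1) * (j%:R + 1 + 1) / (4 * (k%:R + 1)) =
     j%:R * (j%:R + 1) / (4 * (k%:R + 1)) + (j%:R + 1) / (2 * (k%:R + 1)) :> F.
    by field; rewrite gt_eqF //; lra.
  move: IH q1 Tt e0; rewrite -(natr1 k).
  move: (j%:R * (j%:R + 1) / _) ((j%:R + 1) / _) (tau k k) (tau k (k + j)) T0 => x e t T T0.
  move=> IH q1 Tt e0.
  have h1 : T * (1 - e) <= T * q by rewrite ler_wpM2l // ltW.
  have h2 : e * T <= e * t by rewrite ler_wpM2l.
  by apply: le_trans h1; rewrite !mulrBr !mulrBl in IH *; lra.
apply: le_trans (H l); apply: ler_wpM2r; first by rewrite ltW // tau_gt0.
suff : l%:R * (l%:R + 1) / (4 * k.+1%:R) <= 1 / 4 :> F by move: (_ / (4 * _)) => x; lra.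
rewrite ler_pdivrMr ?mulr_gt0 // natr1 -natrM mulrA.
have : (l * l.+1)%:R <= k.+1%:R :> F by rewrite ler_nat.
lra.
Qed.

End tau_bounds.

(** * The weighted mean against the plain mean *)

Section weights.
Variables (F : realFieldType) (al : F).
Hypothesis al_gt0 : 0 < al.
Local Notation gcoef := (gcoef al).
Local Notation gmass := (gmass al).
Local Notation weight l := (fun j => gcoef j * gcoef (l - j)).

Lemma gmassE l : gmass l = \sum_(j < l.+1) weight l j.
Proof. by apply: eq_bigr => j _; rewrite mulr1. Qed.

Lemma weight_sym l j : (j <= l)%N -> weight l (l - j)%N = weight l j.
Proof. by move=> jl /=; rewrite subKn // mulrC. Qed.

(** The sign of [al - 1] decides whether the weights grow or shrink towards the middle, hence which
    side Chebyshev's inequality bounds. *)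
Lemma weight_step l j : (j.*2 < l)%N ->
  exists2 e, 0 <= e & weight l j.+1 - weight l j = (al - 1) * e.
Proof.
move=> jl.
have [n lE] : exists n, (l = j + n.+1)%N by exists (l - j).-1; lia.
have nj : (j <= n)%N by lia.
rewrite lE (_ : j + n.+1 - j = n.+1)%N; last by lia.
rewrite (_ : j + n.+1 - j.+1 = n)%N; last by lia.
rewrite !gcoefS -(natr1 j) -(natr1 n).
have j0 : 0 <= j%:R :> F by [].
have jn : j%:R <= n%:R :> F by rewrite ler_nat.
exists (gcoef j * gcoef n * ((n%:R - j%:R) / ((1 + j%:R) * (1 + n%:R)))).
  have q0 : 0 <= (n%:R - j%:R) / ((1 + j%:R) * (1 + n%:R)) :> F.
    by apply: divr_ge0; [lra|apply: mulr_ge0; lra].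
  by apply: mulr_ge0 q0; apply: mulr_ge0; apply/ltW/gcoef_gt0.
have d1 : 1 + j%:R != 0 :> F by rewrite gt_eqF //; lra.
have d2 : 1 + n%:R != 0 :> F by rewrite gt_eqF //; lra.
by field; rewrite d1 d2.
Qed.

Lemma weight_unimodal l : 1 <= al -> sym_unimodal l (weight l).
Proof.
move=> al1; split=> [j|j /weight_step [e e0 h]]; first exact: weight_sym.
by rewrite -subr_ge0 h mulr_ge0 // subr_ge0.
Qed.

Lemma weight_unimodalN l : al <= 1 -> sym_unimodal l (fun j => - weight l j).
Proof.
move=> al1; split=> [j /weight_sym -> //|j /weight_step [e e0 h]].
by rewrite lerN2 -subr_ge0 -opprB h -mulNr mulr_ge0 // oppr_ge0 subr_le0.
Qed.

Lemma gseqE k l : gseq al k l =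
  (\sum_(j < l.+1) weight l j * tau al (k + j) (k + (l - j))) / gmass l.
Proof. by []. Qed.

Lemma gseq_gt0 k l : 0 < gseq al k l.
Proof.
rewrite gseqE divr_gt0 ?gmass_gt0 // big_ord_recl ltr_wpDr //.
  by apply: sumr_ge0 => j _; rewrite ltW // mulr_gt0 ?tau_gt0 // mulr_gt0 // gcoef_gt0.
by rewrite mulr_gt0 ?tau_gt0 // mulr_gt0 // gcoef_gt0.
Qed.

Lemma gseq_le_diag k l : gseq al k l <= tau al k k.
Proof.
rewrite gseqE ler_pdivrMr ?gmass_gt0 // gmassE mulr_sumr; apply: ler_sum => j _.
rewrite [leRHS]mulrC; apply: ler_wpM2l; last exact: tau_le_diag.
by rewrite mulr_ge0 // ltW // gcoef_gt0.
Qed.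

Lemma gseq_ge_mean k l : 1 <= al -> tau_sum al k l / l.+1%:R <= gseq al k l.
Proof.
move=> al1; rewrite gseqE ler_pdivrMr // mulrAC ler_pdivlMr ?gmass_gt0 //.
rewrite gmassE [leLHS]mulrC [leRHS]mulrC.
exact: chebyshev_unimodal (weight_unimodal l al1) (tau_row_unimodal al_gt0 k l).
Qed.

Lemma gseq_le_mean k l : al <= 1 -> gseq al k l <= tau_sum al k l / l.+1%:R.
Proof.
move=> al1; rewrite gseqE ler_pdivlMr // mulrAC ler_pdivrMr ?gmass_gt0 //.
rewrite gmassE [leLHS]mulrC [leRHS]mulrC -lerN2 -mulNr -mulrN -!sumrN.
have := chebyshev_unimodal (weight_unimodalN l al1) (tau_row_unimodal al_gt0 k l).
by under [X in _ <= _ * X -> _]eq_bigr do rewrite mulNr.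
Qed.

Lemma gseq_ge_weight c k l :
  (forall j, (j <= l)%N -> c * gmass l <= weight l j) ->
  c * tau_sum al k l <= gseq al k l.
Proof.
move=> h; rewrite gseqE ler_pdivlMr ?gmass_gt0 // mulrAC mulr_sumr.
apply: ler_sum => j _; rewrite ler_wpM2r ?(ltW (tau_gt0 _ _ _)) //.
by apply: h; rewrite -ltnS.
Qed.

Lemma gseq_le_weight c k l :
  (forall j, (j <= l)%N -> weight l j <= c * gmass l) ->
  gseq al k l <= c * tau_sum al k l.
Proof.
move=> h; rewrite gseqE ler_pdivrMr ?gmass_gt0 // mulrAC mulr_sumr.
apply: ler_sum => j _; rewrite ler_wpM2r ?(ltW (tau_gt0 _ _ _)) //.
by apply: h; rewrite -ltnS.
Qed.

Lemma gcoef_le i j : 1 <= al -> (i <= j)%N -> gcoef i <= gcoef j.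
Proof.
move=> al1 /subnK <-; elim: (j - i)%N => [//|n IH].
apply: (le_trans IH); rewrite addSn gcoefS ler_peMr ?(ltW (gcoef_gt0 _ _)) //.
by rewrite ler_pdivlMr // mul1r -natr1 addrC lerD2r.
Qed.

Lemma gcoef_ge i j : al <= 1 -> (i <= j)%N -> gcoef j <= gcoef i.
Proof.
move=> al1 /subnK <-; elim: (j - i)%N => [//|n IH].
apply: le_trans IH; rewrite addSn gcoefS ler_piMr ?(ltW (gcoef_gt0 _ _)) //.
by rewrite ler_pdivrMr // mul1r -natr1 addrC lerD2l.
Qed.

End weights.

Section half.
Variable F : realFieldType.
Local Notation h := (2^-1 : F).

(** For [al = 1/2] the generating function (1 - t)^(-2 al) is the geometric series. *)
Lemma gmass_half l : gmass h l = 1.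
Proof.
elim: l => [|l IH]; first by rewrite gmass0 // invr_gt0.
have p : l.+1%:R != 0 :> F by rewrite pnatr_eq0.
by apply: (mulfI p); rewrite gmassS ?invr_gt0 // IH !mulr1 mulfV ?pnatr_eq0 // natr1.
Qed.

(** [gcoef h n] is the central binomial coefficient divided by 4^n, and 4 n times its square is
    nondecreasing from the value 1 at n = 1. This is why [H] is shifted by one. *)
Lemma gcoef_half_sqr_ge l : 1 <= 4 * l.+1%:R * gcoef h l ^+ 2.
Proof.
suff H : forall n, 1 <= 4 * n.+1%:R * gcoef h n.+1 ^+ 2.
  case: l => [|l]; first by rewrite gcoef0 expr1n; lra.
  apply: le_trans (H l) _; rewrite ler_wpM2r ?sqr_ge0 // ler_wpM2l // ler_nat; lia.
elim=> [|n IH].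
  by rewrite gcoefS gcoef0; lra.
apply: (le_trans IH); rewrite [in leRHS]gcoefS exprMn -(natr1 n.+1) -(natr1 n).
have n0 : 0 <= n%:R :> F by [].
move: (gcoef h n.+1 ^+ 2) (sqr_ge0 (gcoef h n.+1)) n0 => x x0.
move: (n%:R) => y y0.
rewrite expr_div_n !mulrA ler_pdivlMr ?exprn_gt0 //; last lra.
rewrite -subr_ge0; set e := (X in 0 <= X).
have -> : e = x * (y + 1 + 1) by rewrite /e; field.
by rewrite mulr_ge0 //; lra.
Qed.

Lemma gseq_half_ge k l : (4 * l.+1%:R)^-1 * tau_sum h k l <= gseq h k l.
Proof.
have h0 : 0 < h by rewrite invr_gt0.
have h1 : h <= 1 by rewrite invf_le1 ?ler1n // ltr0n.
apply: gseq_ge_weight => // j jl; rewrite gmass_half mulr1.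
apply: (@le_trans _ _ (gcoef h l ^+ 2)).
  by rewrite -[leLHS]mul1r ler_pdivrMr ?mulr_gt0 // mulrC gcoef_half_sqr_ge.
rewrite expr2; apply: ler_pM; rewrite ?(ltW (gcoef_gt0 _ _)) ?gcoef_ge //.
by rewrite leq_subr.
Qed.
End half.

Section big_al.
Variables (R : realType) (al : R).
Hypothesis al_ge1 : 1 <= al.

(** Dictated by the induction step below. With b = al - 1 and i = l + 1, the part 2 b of [c] cancels
    the term -2 b i (i+1), and the part 2 b^2 turns -b^2 (i+1)^2 into b^2 (i^2 - 1) >= 0. *)
Let c := 2 * (al - 1) + 2 * (al - 1) ^+ 2.

Let al_gt0 : 0 < al. Proof. exact: lt_le_trans al_ge1. Qed.

(** For [al >= 1] no weight exceeds [gcoef al l ^+ 2]; this compares that maximum with the mean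
    weight. *)
Lemma gcoef_sqr_le l :
  gcoef al l ^+ 2 * l.+1%:R <= expR c * gmass al l.
Proof.
have al1 := al_ge1.
have c0 : 0 <= c by rewrite /c addr_ge0 // mulr_ge0 ?sqr_ge0 // subr_ge0.
(* The strengthened exponent grows by c/((l+1)(l+2)) at each step. This covers the growth of the
   quotient, since exp x >= 1 + x, and it telescopes to less than [c]. *)
suff : gcoef al l ^+ 2 * l.+1%:R <= expR (c * (1 - l.+1%:R^-1)) * gmass al l.
  move=> /le_trans; apply; rewrite ler_wpM2r ?(ltW (gmass_gt0 _ _)) // ler_expR.
  by rewrite ler_piMr // gerBl.
elim: l => [|l IH].
  by rewrite gcoef0 gmass0 // invr1 subrr mulr0 expR0 expr1n.
have i0 : 0 < l.+1%:R :> R by [].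
have i1 : 1 <= l.+1%:R :> R by rewrite ler1n.
have i0' : l.+1%:R != 0 :> R by rewrite pnatr_eq0.
have i1' : 1 + l.+1%:R != 0 :> R by rewrite nat1r pnatr_eq0.
have gE : gmass al l.+1 = gmass al l * ((l%:R + 2 * al) / l.+1%:R).
  by rewrite mulrA mulrC [gmass _ _ * _]mulrC -gmassS // mulKf.
have -> : c * (1 - l.+2%:R^-1) = c * (1 - l.+1%:R^-1) + c / (l.+1%:R * l.+2%:R).
  rewrite -(natr1 l.+1); move: (l.+1%:R) i0' i1' => i i0' i1'.
  by field; rewrite i0' addrC i1'.
rewrite expRD gE gcoefS.
have lE : l%:R = l.+1%:R - 1 :> R by rewrite -natr1 addrK.
have lE2 : l.+2%:R = l.+1%:R + 1 :> R by rewrite natr1.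
rewrite {}lE {}lE2; move: IH i0 i1 i0' i1'.
move: (l.+1%:R) (expR (c * _)) (gcoef al l) (gmass al l)
  (gmass_gt0 al_gt0 l) (expR_gt0 (c * (1 - l.+1%:R^-1))).
move=> i E a g g0 E0 IH i0 i1 i0' i1'.
have h1 : 1 + c / (i * (i + 1)) <= expR (c / (i * (i + 1))) by exact: expR_ge1Dx.
apply: (@le_trans _ _ (E * (1 + c / (i * (i + 1))) *
  (g * ((i - 1 + 2 * al) / i)))); last first.
  apply: ler_wpM2r; last by rewrite ler_wpM2l // ltW.
  by apply: mulr_ge0; [exact: ltW|apply: divr_ge0; lra].
have -> : (a * ((al + (i - 1)) / i)) ^+ 2 * (i + 1) =
  (a ^+ 2 * i) * ((al + (i - 1)) ^+ 2 * (i + 1) / i ^+ 3) by field.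
apply: (@le_trans _ _ (E * g * ((al + (i - 1)) ^+ 2 * (i + 1) / i ^+ 3))).
  apply: ler_wpM2r IH; apply: divr_ge0; last by rewrite exprn_ge0 // ltW.
  by apply: mulr_ge0; [exact: sqr_ge0|lra].
rewrite -subr_ge0; set D := (X in 0 <= X).
have -> : D = E * g *
    (((al - 1) ^+ 2 * (i ^+ 2 - 1) + 2 * (al - 1) * c * i) / (i ^+ 3 * (i + 1))).
  by rewrite /D /c; field; rewrite i0' addrC i1'.
apply: mulr_ge0; first by rewrite mulr_ge0 // ltW.
apply: divr_ge0; last by rewrite mulr_ge0 ?exprn_ge0 ?addr_ge0 // ltW.
apply: addr_ge0; apply: mulr_ge0; rewrite ?sqr_ge0 ?(ltW i0) //.
  by rewrite subr_ge0 exprn_ege1.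
by rewrite mulr_ge0 // mulr_ge0 // subr_ge0.
Qed.

Lemma gseq_big_le k l : gseq al k l <= expR c * (tau_sum al k l / l.+1%:R).
Proof.
rewrite mulrA mulrAC.
apply: gseq_le_weight => // j jl.
rewrite mulrAC ler_pdivlMr //.
apply: le_trans (gcoef_sqr_le l); rewrite ler_wpM2r //.
rewrite expr2; apply: ler_pM; rewrite ?(ltW (gcoef_gt0 _ _)) ?gcoef_le //.
by rewrite leq_subr.
Qed.
End big_al.

(** * Two-sided bound for [gseq] *)

Section gseq_bounds.
Variables (R : realType) (al : R).
Hypothesis al_half : al = 2^-1 \/ 1 <= al.

Let al_gt0 : 0 < al.
Proof. by case: al_half => [->|]; [rewrite invr_gt0|apply: lt_le_trans]. Qed.

Lemma gseq_mean : exists c C : R, [/\ 0 < c, 0 < C & forall k l,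
  c * (tau_sum al k l / l.+1%:R) <= gseq al k l <= C * (tau_sum al k l / l.+1%:R)].
Proof.
case: al_half => [->|al1].
  have h1 : 2^-1 <= 1 :> R by rewrite invf_le1 ?ler1n // ltr0n.
  exists 4^-1, 1; split=> // k l.
  rewrite mul1r gseq_le_mean ?invr_gt0 // andbT.
  apply: le_trans (gseq_half_ge _ _ _).
  by rewrite invfM mulrA mulrAC.
exists 1, (expR (2 * (al - 1) + 2 * (al - 1) ^+ 2)); split; rewrite ?expR_gt0 // => k l.
by rewrite mul1r gseq_ge_mean //= gseq_big_le.
Qed.

(* [2 al + 2] is the dimension of the ambient space. *)
Definition Lam (k l : nat) : R :=
  4 * k%:R + l%:R ^+ 2 + (2 * al + 2) * l%:R + (2 * al + 2).

(** The mean bound controls [gseq] times l + 1, the diagonal bound controls its square times k + al,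
    and [Lam k l] is at most 4 (k + al) + (2 al + 2)(l + 1)^2. *)
Lemma gseq_sqr_upper : exists2 C : R, 0 < C & forall k l, gseq al k l ^+ 2 * Lam k l <= C.
Proof.
have [c [C [_ C0 H]]] := gseq_mean; have al0 := al_gt0.
pose D := C * (1 + 2 * al).
exists (4 * (2 * al + 1) + (2 * al + 2) * D ^+ 2).
  by rewrite addr_gt0 // ?mulr_gt0 ?exprn_gt0 ?mulr_gt0 //; lra.
move=> k l; have X0 := gseq_gt0 al_gt0 k l.
have k0 : 0 <= k%:R :> R by []. have l0 : 0 <= l%:R :> R by [].
have X1 : gseq al k l * (l%:R + 1) <= D.
  have /andP[_ h] := H k l.
  rewrite natr1 -ler_pdivlMr //; apply: (le_trans h).
  rewrite mulrA ler_wpM2r ?invr_ge0 // ler_wpM2l ?(ltW C0) // tau_sum_le //.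
have X2 : (k%:R + al) * gseq al k l ^+ 2 <= 2 * al + 1.
  apply: le_trans (tau_diag_le al_gt0 k).
  apply: ler_pM; rewrite ?sqr_ge0 //; [lra|lra|].
  by rewrite ler_sqr ?nnegrE ?(ltW X0) ?(ltW (tau_gt0 _ _ _)) // gseq_le_diag.
have X3 : (gseq al k l * (l%:R + 1)) ^+ 2 <= D ^+ 2.
  by rewrite ler_sqr ?nnegrE ?(le_trans _ X1) // mulr_ge0 ?(ltW X0) // addr_ge0.
apply: (@le_trans _ _ (4 * ((k%:R + al) * gseq al k l ^+ 2) +
    (2 * al + 2) * (gseq al k l * (l%:R + 1)) ^+ 2)); last first.
  by rewrite lerD // ler_wpM2l //; lra.
rewrite -subr_ge0 /Lam; set e := (X in 0 <= X).
have -> : e = gseq al k l ^+ 2 * (4 * al + (2 * al + 1) * l%:R ^+ 2 + (2 * al + 2) * l%:R).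
  by rewrite /e; ring.
by rewrite mulr_ge0 ?sqr_ge0 // !addr_ge0 ?mulr_ge0 ?sqr_ge0 //; lra.
Qed.

Lemma gseq_sqr_lower : exists2 c : R, 0 < c & forall k l, c <= gseq al k l ^+ 2 * Lam k l.
Proof.
have [c [C [c0 _ H]]] := gseq_mean; have al0 := al_gt0.
exists ((c * (3 / 4)) ^+ 2 * al) => [|k l].
  by rewrite mulr_gt0 // exprn_gt0 // mulr_gt0.
(* Raising [k] to [K] only lowers the sum, and [l * l.+1 <= K] keeps every entry above 3/4 of
   [tau al K K]. Still [K] does not exceed the order of [Lam k l]. *)
pose K := maxn k (l * l.+1).
have t0 := tau_gt0 al_gt0 K K.
have h1 : c * (3 / 4) * tau al K K <= gseq al k l.
  have /andP[h _] := H k l; apply: le_trans h; rewrite -mulrA ler_wpM2l ?(ltW c0) //.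
  rewrite ler_pdivlMr // (le_trans _ (tau_sum_antitone al_gt0 l (leq_maxl k (l * l.+1)))) //.
  apply: (@le_trans _ _ (tau al K (K + l) * l.+1%:R)).
    by rewrite ler_wpM2r // tau_off_diag_ge // leqW // leq_maxr.
  rewrite mulr_natr -[in leLHS](card_ord l.+1) -sumr_const; apply: ler_sum => j _.
  have := sym_unimodal_le (tau_row_unimodal al_gt0 K l) (leq0n l).
  by rewrite subn0 min0n addn0; apply => //; rewrite -ltnS.
have h2 : al <= (K%:R + al) * tau al K K ^+ 2.
  have := tau_diag_ge al_gt0 K; nra.
have h3 : K%:R + al <= Lam k l.
  have k0 : 0 <= k%:R :> R by []. have l0 : 0 <= l%:R :> R by [].
  rewrite /K /Lam /maxn; case: ifP => _; last by have := sqr_ge0 (l%:R : R); nra.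
  by rewrite natrM -natr1; nra.
have h4 : (c * (3 / 4) * tau al K K) ^+ 2 <= gseq al k l ^+ 2.
  rewrite ler_sqr ?nnegrE ?(ltW (gseq_gt0 _ _ _)) //.
  by apply: mulr_ge0; [rewrite mulr_ge0 //|]; exact: ltW.
apply: (@le_trans _ _ ((c * (3 / 4) * tau al K K) ^+ 2 * (K%:R + al))).
  by rewrite [in leRHS]exprMn -[leRHS]mulrA [tau al K K ^+ 2 * _]mulrC ler_wpM2l ?sqr_ge0.
by apply: ler_pM; rewrite ?sqr_ge0 // addr_ge0 // ltW.
Qed.
End gseq_bounds.

Local Open Scope classical_set_scope.
Local Open Scope ring_scope.

(** * Polar coordinates and moments of the sphere *)

Section real_integrals.
Variable R : realType.
Local Notation leb := (@lebesgue_measure R).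

Lemma measurable_natr_bool d (T : measurableType d) (b : T -> bool) :
  measurable_fun setT b -> measurable_fun setT (fun x => (b x)%:R : R).
Proof.
move=> mb; rewrite (_ : (fun x => _) = fun x => if b x then 1 else 0 : R); last first.
  by apply/funext => x; case: (b x).
exact: measurable_fun_ifT.
Qed.

Lemma integral_itv_mkcond (i : interval R) (f : R -> R) :
  (\int[leb]_(x in [set` i]) (f x)%:E = \int[leb]_x (f x * (x \in i)%:R)%:E)%E.
Proof.
rewrite integral_mkcond; apply: eq_integral => x _.
by rewrite /patch mem_setE; case: (x \in i); rewrite ?mulr1 ?mulr0.
Qed.

Lemma is_derive_gauss_fun (x : R) :
  is_derive x 1 (fun y => - gauss_fun y) (2 * x * gauss_fun x).
Proof.
rewrite /gauss_fun; apply: is_derive_eq.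
by rewrite /GRing.scale /=; ring.
Qed.

Lemma integral_gauss_tail (a : R) : 0 <= a ->
  (\int[leb]_(x in `[a, +oo[) (2 * x * gauss_fun x)%:E = (gauss_fun a)%:E)%E.
Proof.
move=> a0; rewrite (@ge0_continuous_FTC2y R _ (fun y => - gauss_fun y) a 0).
- by rewrite sub0e -EFinN opprK.
- move=> x ax; rewrite !mulr_ge0 ?gauss_fun_ge0 //; exact: le_trans ax.
- apply: continuous_subspaceT => x.
  by apply: cvgM; [apply: cvgM; [exact: cvg_cst|exact: cvg_id]|exact: continuous_gauss_fun].
- by rewrite -oppr0; apply: cvgN; exact: cvg_gauss_fun.
- by move=> x _; have [] := is_derive_gauss_fun x.
- apply: cvgN; apply: cvg_at_right_filter; exact: continuous_gauss_fun.
- by move=> x _; rewrite derive1E; have [_ ->] := is_derive_gauss_fun x.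
Qed.

Lemma integral_monomial (n : nat) (a b : R) : 0 <= a -> a <= b ->
  (\int[leb]_(x in `[a, b]) (n.+1%:R * x ^+ n)%:E = (b ^+ n.+1 - a ^+ n.+1)%:E)%E.
Proof.
move=> a0; rewrite le_eqVlt => /predU1P[->|ab].
  by rewrite set_itv1 integral_set1 subrr.
rewrite (@continuous_FTC2 R _ (fun y => y ^+ n.+1) a b) //.
- apply: continuous_subspaceT => x.
  by apply: cvgM; [exact: cvg_cst|exact: exprn_continuous].
- split=> [x _| |]; first exact: exprn_derivable.
    by apply: cvg_at_right_filter; exact: exprn_continuous.
  by apply: cvg_at_left_filter; exact: exprn_continuous.
- by move=> x _; rewrite exp_derive1.
Qed.

Definition half_gauss_moment (s : nat) : \bar R :=
  (\int[leb]_(t in `[0%R, +oo[) (t ^+ s * gauss_fun t)%:E)%E.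

(** Integration by parts in the form of Tonelli: the kernel (s+1) t^s 2 u exp(-u^2) on 0 <= t <= u
    is integrated in both orders. Being nonnegative, it requires no prior knowledge of
    finiteness. *)
Lemma half_gauss_momentSS s :
  (2%:E * half_gauss_moment s.+2 = s.+1%:R%:E * half_gauss_moment s)%E.
Proof.
pose K (z : measurableTypeR R * measurableTypeR R) : \bar R :=
  (s.+1%:R * (z.1 ^+ s) * (2 * z.2 * gauss_fun z.2) * ((0 <= z.1) && (z.1 <= z.2))%:R)%:E.
have mK : measurable_fun setT K.
  apply/measurable_EFinP; apply: measurable_funM.
    apply: measurable_funM.
      by apply: measurable_funM => //; apply: measurable_funX; exact: measurable_fst.
    apply: measurable_funM; first by apply: measurable_funM => //; exact: measurable_snd.
    by apply: (measurableT_comp (@measurable_gauss_fun R)); exact: measurable_snd.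
  apply: measurable_natr_bool; apply: measurable_and.
    by apply: measurable_fun_ler => //; exact: measurable_fst.
  by apply: measurable_fun_ler.
have K0 z : (0 <= K z)%E.
  rewrite lee_fin; case: andP => [[z0 z1]|_]; last by rewrite mulr0.
  by rewrite mulr1 !mulr_ge0 ?exprn_ge0 ?gauss_fun_ge0 // (le_trans z0).
have mG s' : measurable_fun (`[0%R, +oo[%classic : set R)
    (fun t : R => (t ^+ s' * gauss_fun t)%:E).
  apply/measurable_EFinP; apply: measurable_funTS; apply: measurable_funM => //.
  exact: measurable_gauss_fun.
have G0 s' (t : R) : `[0%R, +oo[%classic t -> (0 <= (t ^+ s' * gauss_fun t)%:E)%E.
  by rewrite /= in_itv /= andbT => t0; rewrite lee_fin mulr_ge0 ?exprn_ge0 ?gauss_fun_ge0.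
rewrite /half_gauss_moment -!ge0_integralZl ?lee_fin //;
  [|exact: mG|exact: G0|exact: mG|exact: G0].
transitivity (\int[leb]_u \int[leb]_t K (t, u))%E.
  rewrite [LHS]integral_mkcond; apply: eq_integral => u _.
  rewrite /patch mem_setE in_itv /= andbT.
  rewrite /K /=; have [u0|u0] := leP 0 u; last first.
    rewrite integral0_eq // => t _.
    case: andP => [[t0 /(le_trans t0)]|_]; last by rewrite mulr0.
    by rewrite leNgt u0.
  transitivity (\int[leb]_t ((2 * u * gauss_fun u)%:E *
    (s.+1%:R * t ^+ s * (t \in `[0%R, u])%:R)%:E))%E.
    rewrite ge0_integralZl ?lee_fin ?mulr_ge0 ?gauss_fun_ge0 //; last 2 first.
    - apply/measurable_EFinP; apply: measurable_funM; first exact: measurable_funM.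
      apply: measurable_natr_bool.
      rewrite (_ : (fun t => t \in _) = fun t => (0 <= t) && (t <= u)); last first.
        by apply/funext => t; rewrite in_itv.
      by apply: measurable_and; apply: measurable_fun_ler.
    - move=> t _; rewrite lee_fin in_itv /=; case: andP => [[t0 _]|_]; last by rewrite mulr0.
      by rewrite mulr1 mulr_ge0 ?exprn_ge0.
    rewrite -integral_itv_mkcond integral_monomial // expr0n subr0 -!EFinM.
    by congr (_%:E); rewrite !exprS; ring.
  by apply: eq_integral => t _; rewrite in_itv /= -EFinM; congr (_%:E); ring.
rewrite -(fubini_tonelli K mK K0).
rewrite [RHS]integral_mkcond; apply: eq_integral => t _.
rewrite /patch mem_setE in_itv /= andbT.
rewrite /K /=; have [t0|t0] := leP 0 t; last by rewrite integral0_eq // => u _; rewrite mulr0.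
rewrite EFinM muleA -(integral_gauss_tail t0) integral_itv_mkcond -EFinM.
rewrite -ge0_integralZl ?lee_fin ?mulr_ge0 ?exprn_ge0 //.
- by apply: eq_integral => u _; rewrite in_itv /= andbT -EFinM [in RHS]mulrA.
- apply/measurable_EFinP; apply: measurable_funM.
    by apply: measurable_funM; [exact: measurable_funM|exact: measurable_gauss_fun].
  apply: measurable_natr_bool.
  rewrite (_ : (fun u => u \in _) = fun u => t <= u); last first.
    by apply/funext => u; rewrite in_itv /= andbT.
  exact: measurable_fun_ler.
- move=> u _; rewrite lee_fin in_itv /= andbT; have [tu|_] := leP t u; last by rewrite mulr0.
  by rewrite mulr1 !mulr_ge0 ?gauss_fun_ge0 // (le_trans t0).
Qed.

Lemma half_gauss_moment_ge0 s : (0 <= half_gauss_moment s)%E.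
Proof.
apply: integral_ge0 => t; rewrite /= in_itv /= andbT => t0.
by rewrite lee_fin mulr_ge0 ?exprn_ge0 ?gauss_fun_ge0.
Qed.

Lemma half_gauss_momentE s :
  exists2 g : R, 0 < g & half_gauss_moment s = g%:E.
Proof.
elim/ltn_ind: s => -[|[|s]] IH.
- exists (Num.sqrt pi / 2); first by rewrite divr_gt0 // sqrtr_gt0 pi_gt0.
  rewrite /half_gauss_moment -integral0y_gauss.
  by apply: eq_integral => t _; rewrite mul1r.
- exists 2^-1 => //.
  have := integral_gauss_tail (lexx 0); rewrite /gauss_fun expr0n oppr0 expR0 -/(gauss_fun _).
  have -> : (\int[leb]_(x in `[0%R, +oo[) (2 * x * gauss_fun x)%:E =
     2%:E * half_gauss_moment 1)%E.
    rewrite -ge0_integralZl ?lee_fin //.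
    - by apply: eq_integral => t _; rewrite expr1 -EFinM mulrA.
    - apply/measurable_EFinP; apply: measurable_funTS; apply: measurable_funM => //.
      exact: measurable_gauss_fun.
    - move=> t; rewrite /= in_itv /= andbT => t0.
      by rewrite lee_fin mulr_ge0 ?exprn_ge0 ?gauss_fun_ge0.
  have := half_gauss_moment_ge0 1.
  case: (half_gauss_moment 1) => [g _ [e]|_|//].
    by congr (_%:E); apply: (@mulfI _ 2) => //; rewrite e mulfV.
  by rewrite gt0_muley.
have [g g0 gE] := IH s (leqnSn s.+1).
exists (s.+1%:R * g / 2); first by rewrite divr_gt0 // mulr_gt0.
have := half_gauss_momentSS s; rewrite gE -EFinM.
have := half_gauss_moment_ge0 s.+2.
case: (half_gauss_moment s.+2) => [g' _ [e]|_|//].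
  by congr (_%:E); rewrite -e mulrC mulKf.
by rewrite gt0_muley.
Qed.

Lemma gauss_momentE s :
  (\int[leb]_t (`|t| ^+ s * gauss_fun t)%:E = 2%:E * half_gauss_moment s)%E.
Proof.
rewrite ge0_symfun_integralT //.
- congr (_ * _)%E; rewrite (_ : [set x | _] = `[0, +oo[%classic); last first.
    by apply/seteqP; split => x/=; rewrite in_itv/= andbT.
  apply: eq_integral => t; rewrite inE /= in_itv /= andbT => t0.
  by rewrite ger0_norm.
- by move=> t; rewrite mulr_ge0 ?exprn_ge0 ?gauss_fun_ge0.
- move=> t; apply: cvgM; last exact: continuous_gauss_fun.
  apply: (cvg_comp (fun z : R => `|z|) (fun z => z ^+ s)); last exact: exprn_continuous.
  exact: norm_continuous.
- by move=> t; rewrite /= normrN /gauss_fun sqrrN.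
Qed.
End real_integrals.

(** * Tonelli and diagonal changes of variables for [lebesgue_tuple] *)

Section tuple_integral.
Variable R : realType.
Local Notation leb := (@lebesgue_measure R).
Local Notation X := (measurableTypeR R).
Implicit Types (n : nat).

Lemma ge0_integral_cons n (f : euclid R n.+1 -> \bar R) :
  measurable_fun setT f -> (forall x, 0 <= f x)%E ->
  (\int[lebesgue_tuple n.+1]_x f x =
   \int[leb]_a \int[lebesgue_tuple n]_x f (tuple_cons (a, x)))%E.
Proof.
move=> mf f0.
rewrite [lebesgue_tuple n.+1]/= ge0_integral_pushforward //; last first.
  exact: measurable_tuple_cons.
rewrite preimage_setT fubini_tonelli1 //.
  exact: measurableT_comp mf (@measurable_tuple_cons _ _ _).
by move=> x; exact: f0.
Qed.

(** The rescaled pushforward of Lebesgue measure agrees with it on intervals, hence everywhere by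
    uniqueness. Negative [c] is allowed for the sake of reflections. *)
Lemma ge0_integral_scale1 (c : R) (f : X -> \bar R) : c != 0 ->
  measurable_fun setT f -> (forall x, 0 <= f x)%E ->
  (`|c|%:E * \int[leb]_x f (c * x)%R = \int[leb]_x f x)%E.
Proof.
move=> c0 mf f0.
have mc : measurable_fun [set: X] (fun x : X => c * x : X) by exact: measurable_funM.
pose mu : {measure set X -> \bar R} := mscale (NngNum (normr_ge0 c))
  (measure_function_pushforward__canonical__measure_function_Measure leb mc).
transitivity (\int[mu]_x f x)%E.
  rewrite ge0_integral_mscale // ge0_integral_pushforward //.
apply: eq_measure_integral => A mA _; apply/esym/lebesgue_measure_unique => //.
move=> _ [[a b] /= _ <-].
rewrite /mu /mscale /= /pushforward.
have [cn|cp] := ltP c 0.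
  have -> : (fun x => c * x) @^-1` `]a, b] = `[b / c, a / c[%classic.
    apply/seteqP; split=> x /=; rewrite !in_itv /=.
      by rewrite ler_ndivrMr // ltr_ndivlMr // andbC [x * _]mulrC.
    by rewrite ler_ndivrMr // ltr_ndivlMr // andbC [x * _]mulrC.
  rewrite !lebesgue_measure_itv /= !lte_fin ltr_ndivrMr // divfK //.
  case: ifP => _; last by rewrite mule0.
  rewrite -EFinB -EFinM ltr0_norm //; congr (_%:E).
  by field.
have {}cp : 0 < c by rewrite lt_neqAle eq_sym c0.
have -> : (fun x => c * x) @^-1` `]a, b] = `]a / c, b / c]%classic.
  apply/seteqP; split=> x /=; rewrite !in_itv /=.
    by rewrite ltr_pdivrMr // ler_pdivlMr // [x * _]mulrC.
  by rewrite ltr_pdivrMr // ler_pdivlMr // [x * _]mulrC.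
rewrite !lebesgue_measure_itv /= !lte_fin ltr_pdivrMr // divfK //.
case: ifP => _; last by rewrite mule0.
rewrite -EFinB -EFinM gtr0_norm //; congr (_%:E).
by field.
Qed.

Definition tuple_scale n (c : n.-tuple R) (x : euclid R n) : euclid R n :=
  [tuple tnth c i * tnth x i | i < n].

Lemma measurable_tuple_scale n (c : n.-tuple R) :
  measurable_fun setT (tuple_scale c).
Proof.
apply/measurable_fun_tnthP => i.
rewrite (_ : _ \o _ = fun x : euclid R n => tnth c i * tnth x i); last first.
  by apply/funext => x /=; rewrite tnth_mktuple.
by apply: measurable_funM => //; exact: measurable_tnth.
Qed.

Lemma tuple_scale_cons n a (c : n.-tuple R) y (x : euclid R n) :
  tuple_scale (tuple_cons (a, c)) (tuple_cons (y, x)) =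
  tuple_cons ((a * y : X), tuple_scale c x).
Proof.
apply: eq_from_tnth => i; rewrite tnth_mktuple.
case: (unliftP ord0 i) => [j|] ->; last by rewrite !tnth0.
by rewrite !tnthS tnth_mktuple.
Qed.

(** Diagonal maps serve twice: equal entries give dilations, entries 1 and -1 give reflections. *)
Lemma ge0_integral_tuple_scale n (c : n.-tuple R) (f : euclid R n -> \bar R) :
  (forall i, tnth c i != 0) ->
  measurable_fun setT f -> (forall x, 0 <= f x)%E ->
  ((\prod_(i < n) `|tnth c i|)%:E * \int[lebesgue_tuple n]_x f (tuple_scale c x)
   = \int[lebesgue_tuple n]_x f x)%E.
Proof.
elim: n c f => [|n IH] c f c0 mf f0.
  rewrite big_ord0 mul1e; apply: eq_integral => x _.
  by congr f; rewrite [LHS]tuple0 [RHS]tuple0.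
case/tupleP: c c0 => a c c0.
have a0 : a != 0 by have := c0 ord0; rewrite tnth0.
have {}c0 i : tnth c i != 0 by have := c0 (lift ord0 i); rewrite tnthS.
have mfs : measurable_fun setT (fun x => f (tuple_scale [tuple of a :: c] x)).
  exact: measurableT_comp mf (measurable_tuple_scale _).
rewrite !ge0_integral_cons //.
rewrite big_ord_recl tnth0 EFinM.
rewrite (eq_bigr (fun i => `|tnth c i|)) => [|i _]; last by rewrite tnthS.
set P := \prod_(i < n) `|tnth c i|.
have P0 : 0 <= P by apply: prodr_ge0.
have mcons := @measurable_tuple_cons _ X n.
have mfc : measurable_fun setT (f \o @tuple_cons X n) := measurableT_comp mf mcons.
pose g (y : X) := (\int[lebesgue_tuple n]_x f (tuple_cons (y, x)))%E.
have mg : measurable_fun setT g.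
  exact: (measurable_fun_fubini_tonelli_F (m2 := lebesgue_tuple n) _ mfc (fun x => f0 _)).
have mfy (y : X) : measurable_fun setT (fun x => f (tuple_cons (y, x))).
  by apply: (measurableT_comp mfc); exact: measurable_pair1.
have g0 y : (0 <= g y)%E by apply: integral_ge0.
rewrite -[RHS](ge0_integral_scale1 a0 mg g0) -muleA; congr (_ * _)%E.
rewrite -ge0_integralZl //; last first.
- by move=> y _; apply: integral_ge0.
- apply: (@measurable_fun_fubini_tonelli_F _ _ _ _ _ (lebesgue_tuple n)
    (fun z => f (tuple_scale [tuple of a :: c] (tuple_cons z)))) => //.
  exact: measurableT_comp mfs mcons.
apply: eq_integral => y _; rewrite /g -[RHS](IH c _ c0) //; congr (_ * _)%E.
by apply: eq_integral => x _; rewrite -[in RHS]tuple_scale_cons.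
Qed.
End tuple_integral.

(** * Polar coordinates for homogeneous functions *)

Section radial.
Variables (R : realType) (n : nat).
Local Notation leb := (@lebesgue_measure R).
Local Notation X := (measurableTypeR R).
Local Notation E := (euclid R n).
Local Notation vol := (@lebesgue_tuple R n).

Definition dilate (t : R) (x : E) : E := tuple_scale [tuple of nseq n t] x.

Lemma enorm_ge0 (x : E) : 0 <= enorm x. Proof. exact: sqrtr_ge0. Qed.

Lemma nth_dilate t (x : E) i : (dilate t x)`_i = t * x`_i.
Proof.
have [ni|ni] := ltnP i n; last by rewrite !nth_default ?size_tuple // mulr0.
have nthE (y : E) : y`_i = tnth y (Ordinal ni) by rewrite (tnth_nth 0).
by rewrite !nthE tnth_mktuple (tnth_nth 0) nth_nseq ltn_ord.
Qed.

Lemma nth_normalize (x : E) i : (normalize x)`_i = x`_i / enorm x.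
Proof.
have [ni|ni] := ltnP i n; last by rewrite !nth_default ?size_tuple // mul0r.
have nthE (y : E) : y`_i = tnth y (Ordinal ni) by rewrite (tnth_nth 0).
by rewrite !nthE tnth_mktuple.
Qed.

Lemma enorm_dilate t (x : E) : 0 <= t -> enorm (dilate t x) = t * enorm x.
Proof.
move=> t0; rewrite /enorm -[in RHS](ger0_norm t0) -sqrtr_sqr -sqrtrM ?sqr_ge0 //.
congr Num.sqrt; rewrite mulr_sumr; apply: eq_bigr => i _.
by rewrite !(tnth_nth 0) nth_dilate exprMn.
Qed.

Lemma normalize_dilate t (x : E) : 0 < t -> normalize (dilate t x) = normalize x.
Proof.
move=> t0; apply: eq_from_tnth => i.
rewrite !(tnth_nth 0) !nth_normalize nth_dilate enorm_dilate ?ltW //.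
by rewrite invfM mulrACA mulfV ?mul1r ?gt_eqF.
Qed.

Lemma enorm_normalize (x : E) : 0 < enorm x -> enorm (normalize x) = 1.
Proof.
move=> x0; have -> : normalize x = dilate (enorm x)^-1 x.
  apply: eq_from_tnth => i; rewrite !(tnth_nth 0) nth_normalize nth_dilate.
  by rewrite mulrC.
by rewrite enorm_dilate ?invr_ge0 ?ltW // mulVf ?gt_eqF.
Qed.

Lemma measurable_nth i : measurable_fun setT (fun x : E => x`_i).
Proof.
have [ni|ni] := ltnP i n.
  rewrite (_ : (fun x : E => _) = fun x : E => tnth x (Ordinal ni)).
    exact: measurable_tnth.
  by apply/funext => x; rewrite (tnth_nth 0).
rewrite (_ : (fun x : E => _) = cst 0) //.
by apply/funext => x; rewrite nth_default // size_tuple.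
Qed.

Lemma ge0_integral_dilate t (f : E -> \bar R) : 0 < t ->
  measurable_fun setT f -> (forall x, 0 <= f x)%E ->
  ((t ^+ n)%:E * \int[vol]_x f (dilate t x) = \int[vol]_x f x)%E.
Proof.
move=> t0 mf f0; rewrite -[RHS](@ge0_integral_tuple_scale _ _ [tuple of nseq n t]) //.
  congr (_%:E * _)%E; rewrite (eq_bigr (fun=> t)) => [|i _].
    by rewrite big_const card_ord iter_mulr_1.
  by rewrite (tnth_nth 0) nth_nseq ltn_ord gtr0_norm.
by move=> i; rewrite (tnth_nth 0) nth_nseq ltn_ord gt_eqF.
Qed.

Definition ball_integral (P : E -> R) (t : R) : \bar R :=
  (\int[vol]_x (P x * (0 < enorm x <= t)%R%:R)%:E)%E.

Definition homogeneous (q : nat) (P : E -> R) :=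
  forall t x, 0 < t -> P (dilate t x) = t ^+ q * P x.

Lemma measurable_in_ball t :
  measurable_fun setT (fun x : E => (0 < enorm x <= t)%R%:R : R).
Proof.
apply: measurable_natr_bool; apply: measurable_and.
  by apply: measurable_fun_ltr => //; exact: measurable_enorm.
by apply: measurable_fun_ler => //; exact: measurable_enorm.
Qed.

Lemma ball_integral_scale q (P : E -> R) t : 0 < t -> measurable_fun setT P ->
  (forall x, 0 <= P x) -> homogeneous q P ->
  ball_integral P t = ((t ^+ (q + n))%:E * ball_integral P 1)%E.
Proof.
move=> t0 mP P0 hP; rewrite /ball_integral.
have mf s : measurable_fun setT (fun x => (P x * (0 < enorm x <= s)%R%:R)%:E).
  by apply/measurable_EFinP; apply: measurable_funM => //; exact: measurable_in_ball.
have f0 s x : (0 <= (P x * (0 < enorm x <= s)%R%:R)%:E)%E by rewrite lee_fin mulr_ge0.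
rewrite -(ge0_integral_dilate t0) // exprD mulrC EFinM -muleA.
congr (_ * _)%E; rewrite -ge0_integralZl ?lee_fin ?exprn_ge0 ?ltW //.
apply: eq_integral => x _; rewrite hP // enorm_dilate ?(ltW t0) //.
by rewrite pmulr_rgt0 // ger_pMr // -EFinM mulrA.
Qed.

(* Layer-cake form of polar coordinates: Fubini on the pairs [(x, t)] with
   [|x| <= t] *)
Lemma radial_integral q (P : E -> R) (phi : R -> R) : (0 < n)%N -> measurable_fun setT P ->
  (forall x, 0 <= P x) -> homogeneous q P -> measurable_fun setT phi ->
  (forall t, 0 <= t -> 0 <= phi t) ->
  (\int[vol]_x ((P x * (0 < enorm x)%R%:R)%:E * \int[leb]_(t in `[enorm x, +oo[) (phi t)%:E)
   = ball_integral P 1 * \int[leb]_(t in `[0%R, +oo[) (phi t * t ^+ (q + n))%:E)%E.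
Proof.
move=> n0 mP P0 hP mphi phi0.
pose K (z : E * X) : \bar R := (P z.1 * phi z.2 * (0 < enorm z.1 <= z.2)%R%:R)%:E.
have mE1 : measurable_fun setT (fun z : E * X => enorm z.1).
  by apply: (measurableT_comp (@measurable_enorm R n)); exact: measurable_fst.
have mK : measurable_fun setT K.
  apply/measurable_EFinP; apply: measurable_funM.
    apply: measurable_funM.
      by apply: (measurableT_comp mP); exact: measurable_fst.
    by apply: (measurableT_comp mphi); exact: measurable_snd.
  apply: measurable_natr_bool; apply: measurable_and.
    exact: measurable_fun_ltr.
  by apply: measurable_fun_ler.
have K0 z : (0 <= K z)%E.
  rewrite lee_fin; case: andP => [[z0 z1]|_]; last by rewrite mulr0.
  by rewrite mulr1 mulr_ge0 // phi0 // (le_trans _ z1) // ltW.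
transitivity (\int[vol]_x \int[leb]_t K (x, t))%E.
  apply: eq_integral => x _; rewrite integral_itv_mkcond.
  have [x0|x0] := boolP (0 < enorm x); last first.
    rewrite mulr0 mul0e integral0_eq // => t _.
    by rewrite /K /= (negbTE x0) mulr0.
  rewrite mulr1 -ge0_integralZl ?lee_fin //.
  - apply: eq_integral => t _; rewrite /K /= x0 in_itv /= andbT.
    by rewrite -EFinM mulrA.
  - apply/measurable_EFinP; apply: measurable_funM => //.
    apply: measurable_natr_bool.
    rewrite (_ : (fun t => t \in _) = fun t => enorm x <= t); last first.
      by apply/funext => u; rewrite in_itv /= andbT.
    exact: measurable_fun_ler.
  - move=> t _; rewrite lee_fin in_itv /= andbT.
    have [xt|_] := leP (enorm x) t; last by rewrite mulr0.
    by rewrite mulr1 phi0 // (le_trans _ xt) // enorm_ge0.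
rewrite (fubini_tonelli K mK K0) integral_itv_mkcond.
rewrite -ge0_integralZl //; last first.
- by apply: integral_ge0 => x _; rewrite lee_fin mulr_ge0.
- move=> t _; rewrite lee_fin in_itv /= andbT.
  have [t0|_] := leP 0 t; last by rewrite mulr0.
  by rewrite mulr1 mulr_ge0 ?exprn_ge0 // phi0.
- apply/measurable_EFinP; apply: measurable_funM.
    exact: measurable_funM.
  apply: measurable_natr_bool.
  rewrite (_ : (fun t => t \in _) = fun t => 0 <= t); last first.
    by apply/funext => u; rewrite in_itv /= andbT.
  exact: measurable_fun_ler.
apply: eq_integral => t _; rewrite in_itv /= andbT.
have [t0|t0] := ltP 0 t; last first.
  rewrite integral0_eq => [|x _]; last first.
    rewrite /K /=; case: andP => [[x0 xt]|_]; last by rewrite mulr0.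
    by have := lt_le_trans x0 (le_trans xt t0); rewrite ltxx.
  have -> : phi t * t ^+ (q + n) * (0 <= t)%R%:R = 0.
    have [t0'|_] := leP 0 t; last by rewrite mulr0.
    have -> : t = 0 by apply/eqP; rewrite eq_le t0 t0'.
    by rewrite expr0n addn_eq0 (gtn_eqF n0) andbF mulr0 mul0r.
  by rewrite mule0.
rewrite (ltW t0) mulr1 EFinM muleCA [(ball_integral P 1 * _)%E]muleC -ball_integral_scale //.
rewrite -ge0_integralZl ?lee_fin ?phi0 ?(ltW t0) //.
- by apply: eq_integral => x _; rewrite -EFinM mulrA [phi t * _]mulrC.
- by apply/measurable_EFinP; apply: measurable_funM => //; exact: measurable_in_ball.
- by move=> x _; rewrite lee_fin mulr_ge0.
Qed.

Definition gauss_integral (P : E -> R) : \bar R :=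
  (\int[vol]_x (P x * gauss_fun (enorm x))%:E)%E.

Lemma measurable_gauss_enorm : measurable_fun setT (fun x : E => gauss_fun (enorm x)).
Proof. exact: measurableT_comp (@measurable_gauss_fun R) (@measurable_enorm R n). Qed.

(** This is [radial_integral] for 2 t exp(-t^2), whose tail integral from [enorm x] is the Gaussian
    at [x]. The origin, left out there, is a null set. *)
Lemma gauss_integralE q (P : E -> R) : (0 < n)%N ->
  vol [set x | enorm x = 0] = 0%E -> measurable_fun setT P ->
  (forall x, 0 <= P x) -> homogeneous q P ->
  gauss_integral P = (2%:E * half_gauss_moment R (q + n).+1 * ball_integral P 1)%E.
Proof.
move=> n0 vol0 mP P0 hP.
have -> : (2%:E * half_gauss_moment R (q + n).+1 =
   \int[leb]_(t in `[0%R, +oo[) (2 * `|t| * gauss_fun t * t ^+ (q + n))%:E)%E.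
  rewrite -ge0_integralZl ?lee_fin //.
  - apply: eq_integral => t; rewrite inE /= in_itv /= andbT => t0.
    by rewrite ger0_norm // -EFinM exprS; congr (_%:E); ring.
  - apply/measurable_EFinP; apply: measurable_funTS; apply: measurable_funM => //.
    exact: measurable_gauss_fun.
  - move=> t; rewrite /= in_itv /= andbT => t0.
    by rewrite lee_fin mulr_ge0 ?exprn_ge0 ?gauss_fun_ge0.
rewrite muleC -(@radial_integral q P (fun t => 2 * `|t| * gauss_fun t)) //; last 2 first.
- apply: measurable_funM; last exact: measurable_gauss_fun.
  by apply: measurable_funM.
- by move=> t t0; rewrite !mulr_ge0 ?gauss_fun_ge0.
transitivity (\int[vol]_x ((P x * (0 < enorm x)%R%:R) * gauss_fun (enorm x))%:E)%E.
  apply: ae_eq_integral => //.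
  - by apply/measurable_EFinP; apply: measurable_funM => //; exact: measurable_gauss_enorm.
  - apply/measurable_EFinP; apply: measurable_funM; last exact: measurable_gauss_enorm.
    apply: measurable_funM => //; apply: measurable_natr_bool.
    by apply: measurable_fun_ltr => //; exact: measurable_enorm.
  - exists [set x | enorm x = 0]; split=> //.
      rewrite -[X in measurable X]setTI.
      exact: (@measurable_enorm R n measurableT [set 0] (measurable_set1 0)).
    move=> x /= xn; apply/eqP; apply: contra_notT xn => x0 _.
    by rewrite lt_neqAle eq_sym x0 enorm_ge0 mulr1.
apply: eq_integral => x _; rewrite EFinM; congr (_ * _)%E.
rewrite -(integral_gauss_tail (enorm_ge0 x)).
apply: eq_integral => t; rewrite inE /= in_itv /= andbT => xt.
by rewrite ger0_norm // (le_trans _ xt) // enorm_ge0.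
Qed.

Lemma homogeneous_normalize q (P : E -> R) x : homogeneous q P -> 0 < enorm x ->
  P x = enorm x ^+ q * P (normalize x).
Proof.
move=> hP x0; rewrite -hP //; congr P; apply: eq_from_tnth => i.
by rewrite !(tnth_nth 0) nth_dilate nth_normalize mulrCA mulfV ?mulr1 ?gt_eqF.
Qed.

(** Both sides are the integral of [P] over the sphere: the left one by cones, the right one because
    the radial factor r^(q+n-1) integrates to 1/(q+n). Finiteness permits the subtraction at the
    end. *)
Lemma ball_integral_normalize q (P : E -> R) : (0 < n)%N ->
  measurable_fun setT P -> (forall x, 0 <= P x) -> homogeneous q P ->
  (ball_integral (P \o @normalize R n) 1 < +oo)%E ->
  (n%:R%:E * ball_integral (P \o @normalize R n) 1 = (q + n)%:R%:E * ball_integral P 1)%E.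
Proof.
move=> n0 mP P0 hP fin; set Q := P \o _ in fin *.
case: q hP => [|q] hP.
  congr (_ * _)%E; apply: eq_integral => x _.
  have [x0|] := boolP (0 < enorm x); last by rewrite !mulr0.
  by rewrite /Q /= [P x in RHS](homogeneous_normalize hP) // mul1r.
have mQ : measurable_fun setT Q := measurableT_comp mP (@measurable_normalize R n).
have hQ : homogeneous 0 Q by move=> t x t0; rewrite /Q /= normalize_dilate // mul1r.
(* With [q] lowered by one, [P] is |x|^(q+1) [Q], and the tail integral of [phi] from |x| is 1 -
   |x|^(q+1) in the ball: it produces [Q - P]. *)
pose phi (t : R) := q.+1%:R * t ^+ q * (t <= 1)%R%:R.
have mphi : measurable_fun setT phi.
  apply: measurable_funM; first exact: measurable_funM.
  by apply: measurable_natr_bool; exact: measurable_fun_ler.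
have phi0 t : 0 <= t -> 0 <= phi t by move=> t0; rewrite /phi !mulr_ge0 ?exprn_ge0.
have := radial_integral n0 mQ (fun x => P0 _) hQ mphi phi0.
have phi_int (r : R) : 0 <= r ->
    (\int[leb]_(t in `[r, +oo[) (phi t)%:E = (Num.max 0 (1 - r ^+ q.+1))%:E)%E.
  move=> r0; have [r1|r1] := leP r 1.
    rewrite max_r ?subr_ge0 ?exprn_ile1 // -[X in X - _](expr1n _ q.+1) -integral_monomial //.
    rewrite !integral_itv_mkcond; apply: eq_integral => t _.
    rewrite !in_itv /= andbT /phi; case: (r <= t); last by rewrite !mulr0.
    by rewrite mulr1.
  rewrite max_l; last by rewrite subr_le0 exprn_ege1 // ltW.
  rewrite integral0_eq // => t; rewrite /= in_itv /= andbT => rt.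
  by rewrite /phi leNgt (lt_le_trans r1 rt) mulr0.
have -> : (\int[leb]_(t in `[0%R, +oo[) (phi t * t ^+ (0 + n))%:E =
    (q.+1%:R / (q.+1 + n)%:R)%:E)%E.
  transitivity (((q.+1 + n)%:R^-1 * q.+1%:R)%:E *
      \int[leb]_(t in `[0%R, 1%R]) ((q + n).+1%:R * t ^+ (q + n))%:E)%E.
    rewrite -ge0_integralZl ?lee_fin //; last 2 first.
    - by apply/measurable_EFinP; apply: measurable_funTS; exact: measurable_funM.
    - by move=> t; rewrite /= in_itv /= => /andP[t0 _]; rewrite lee_fin mulr_ge0 ?exprn_ge0.
    rewrite integral_itv_mkcond [RHS]integral_mkcond; apply: eq_integral => t _.
    rewrite /patch mem_setE !in_itv /= andbT /phi add0n.
    have [t0|_] := leP 0 t; last by rewrite mulr0.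
    case: (t <= 1); last by rewrite !mulr0 !mul0r.
    rewrite !mulr1 -EFinM exprD addSn; congr (_%:E).
    have : (q + n).+1%:R != 0 :> R by rewrite pnatr_eq0.
    by move: ((q + n).+1%:R) => y y0; field.
  by rewrite integral_monomial // expr1n expr0n subr0 mule1 mulrC.
pose L := (\int[vol]_x (Q x * (0 < enorm x <= 1)%R%:R * (1 - enorm x ^+ q.+1))%:E)%E.
have -> : (\int[vol]_x ((Q x * (0 < enorm x)%R%:R)%:E *
      \int[leb]_(t in `[enorm x, +oo[) (phi t)%:E) = L)%E.
  apply: eq_integral => x _; rewrite phi_int ?enorm_ge0 // -EFinM.
  have [x1|x1] := leP (enorm x) 1.
    by rewrite max_r ?subr_ge0 ?exprn_ile1 ?enorm_ge0 // andbT.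
  rewrite max_l ?andbF ?mulr0 ?mul0r // subr_le0 exprn_ege1 // ltW //.
have L0 x : 0 <= Q x * (0 < enorm x <= 1)%R%:R * (1 - enorm x ^+ q.+1).
  case: andP => [[_ x1]|_]; last by rewrite mulr0 mul0r.
  by rewrite mulr1 mulr_ge0 ?P0 // subr_ge0 exprn_ile1 // enorm_ge0.
have NE : (ball_integral Q 1 = L + ball_integral P 1)%E.
  rewrite /L /ball_integral -ge0_integralD //.
  - apply: eq_integral => x _; rewrite -EFinD; congr (_%:E).
    case: andP => [[x0 x1]|_]; last by rewrite !mulr0 mul0r addr0.
    by rewrite [P x](homogeneous_normalize hP) // /Q /=; ring.
  - by move=> x _; rewrite lee_fin.
  - apply/measurable_EFinP; apply: measurable_funM.
      by apply: measurable_funM => //; exact: measurable_in_ball.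
    apply: measurable_funB => //; apply: measurable_funX; exact: measurable_enorm.
  - by move=> x _; rewrite lee_fin mulr_ge0.
  - by apply/measurable_EFinP; apply: measurable_funM => //; exact: measurable_in_ball.
move=> LE; move: NE; rewrite LE.
have N0 : (0 <= ball_integral Q 1)%E.
  by apply: integral_ge0 => x _; rewrite lee_fin mulr_ge0 //; exact: P0.
move: fin N0; case: (ball_integral Q 1) => [r| |] // _ _.
have A0 : (0 <= ball_integral P 1)%E.
  by apply: integral_ge0 => x _; rewrite lee_fin mulr_ge0.
move: A0; case: (ball_integral P 1) => [s| |] // _.
rewrite -!EFinM -EFinD => -[rs]; congr (_%:E).
have p : (q.+1 + n)%:R != 0 :> R by rewrite pnatr_eq0.
have -> : s = r - r * (q.+1%:R / (q.+1 + n)%:R).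
  by apply/eqP; rewrite eq_sym subr_eq addrC -rs.
move: p; rewrite natrD => p; by field.
Qed.
End radial.

(** * Surface integrals as integrals over the ball *)

Lemma ge0_integral_mrestr d (T : measurableType d) (R : realType)
    (mu : {measure set T -> \bar R}) (B D : set T) (mB : measurable B) (f : T -> \bar R) :
  measurable D -> measurable_fun D f -> (forall x, D x -> 0 <= f x)%E ->
  (\int[mrestr mu mB]_(x in D) f x = \int[mu]_(x in D `&` B) f x)%E.
Proof.
move=> mD mf f0; rewrite [LHS](@ge0_negligible_integral _ _ _ _ _ (~` B)) //=.
- rewrite setDE setCK; apply: eq_measure_integral => A mA AB.
  by rewrite /= /mrestr setIidl // => x /AB[].
- exact: measurableC.
- by rewrite /mrestr setICl measure0.
Qed.

Section surface.
Variables (R : realType) (n : nat).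
Local Notation E := (euclid R n).
Local Notation vol := (@lebesgue_tuple R n).

Lemma measurable_unit_sphere : measurable (unit_sphere R n).
Proof.
rewrite -[X in measurable X]setTI.
exact: (@measurable_enorm R n measurableT [set 1] (measurable_set1 1)).
Qed.

Lemma ge0_integral_surface (f : E -> R) : measurable_fun setT f -> (forall x, 0 <= f x) ->
  (\int[surface_measure n]_(v in unit_sphere R n) (f v)%:E =
   n%:R%:E * ball_integral (f \o @normalize R n) 1)%E.
Proof.
move=> mf f0.
pose p : {measure set E -> \bar R} :=
  measure_function_pushforward__canonical__measure_function_Measure
    (mrestr vol (@measurable_punctured_ball R n)) (@measurable_normalize R n).
have mS := measurable_unit_sphere.
have mfE D : measurable_fun D (fun v : E => (f v)%:E).
  by apply/measurable_EFinP; exact: measurable_funTS.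
transitivity (\int[mscale (NngNum (ler0n R n)) p]_(v in unit_sphere R n) (f v)%:E)%E.
  by apply: eq_measure_integral.
rewrite ge0_integral_mscale //; last by move=> x _; rewrite lee_fin.
congr (_ * _)%E; rewrite ge0_integral_pushforward //; [|exact: measurable_normalize|].
  rewrite ge0_integral_mrestr //; last 3 first.
  - by rewrite -[X in measurable X]setTI; exact: measurable_normalize.
  - apply: measurable_funTS; apply: (measurableT_comp (mfE setT)).
    exact: measurable_normalize.
  - by move=> x _; rewrite lee_fin.
  rewrite integral_mkcond; apply: eq_integral => x _; rewrite /patch.
  have [x1|x1] := boolP (0 < enorm x <= 1).
    rewrite mem_set ?mulr1 //; split => //; rewrite /preimage /unit_sphere /=.
    by apply: enorm_normalize; case/andP: x1.
  by rewrite mulr0 memNset // => -[_]; apply/negP.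
by move=> x _; rewrite lee_fin.
Qed.

End surface.

(** * Absolute moments of the sphere as quotients of Gaussian moments *)

Section product_moments.
Variable R : realType.
Local Notation leb := (@lebesgue_measure R).
Local Notation X := (measurableTypeR R).
Local Notation G := (half_gauss_moment R).

Lemma enorm_cons n (y : X) (x : euclid R n) :
  enorm (tuple_cons (y, x)) ^+ 2 = y ^+ 2 + enorm x ^+ 2.
Proof.
rewrite /enorm !sqr_sqrtr ?sumr_ge0 // => [|i _|i _]; rewrite ?sqr_ge0 //.
rewrite big_ord_recl tnth0; congr (_ + _).
by apply: eq_bigr => i _; rewrite tnthS.
Qed.

Lemma gauss_fun_enorm_cons n (y : X) (x : euclid R n) :
  gauss_fun (enorm (tuple_cons (y, x))) = gauss_fun y * gauss_fun (enorm x).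
Proof. by rewrite /gauss_fun enorm_cons opprD expRD. Qed.

Lemma nth_le_enorm n (x : euclid R n) i : `|x`_i| <= enorm x.
Proof.
have [ni|ni] := ltnP i n; last by rewrite nth_default ?size_tuple // normr0 sqrtr_ge0.
rewrite -[x`_i]/(x`_(Ordinal ni)) -tnth_nth -sqrtr_sqr ler_sqrt; last first.
  by apply: sumr_ge0 => j _; exact: sqr_ge0.
by rewrite (bigD1 (Ordinal ni)) //= lerDl; apply: sumr_ge0 => j _; exact: sqr_ge0.
Qed.

Lemma lebesgue_tuple_enorm0 n :
  lebesgue_tuple n.+1 [set x : euclid R n.+1 | enorm x = 0] = 0%E.
Proof.
have m0 : measurable [set x : euclid R n.+1 | x`_0 = 0].
  rewrite -[X in measurable X]setTI.
  exact: (@measurable_nth R n.+1 0 measurableT [set 0] (measurable_set1 0)).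
apply: (@subset_measure0 _ _ _ (lebesgue_tuple n.+1) _ [set x | x`_0 = 0]) => //.
- rewrite -[X in measurable X]setTI.
  exact: (@measurable_enorm R n.+1 measurableT [set 0] (measurable_set1 0)).
- by move=> x /= x0; have := nth_le_enorm x 0; rewrite x0 normr_le0 => /eqP.
change ((leb \x lebesgue_tuple n)%E ((@tuple_cons X n) @^-1` [set x | x`_0 = 0]) = 0%E).
have -> : (@tuple_cons X n) @^-1` [set x | x`_0 = 0] = [set 0 : X] `*` setT.
  by apply/seteqP; split=> -[y x] //= [].
rewrite product_measure1E //.
by rewrite [X in (X * _)%E](lebesgue_measure_set1 (0 : R)) mul0e.
Qed.

Lemma gauss_integral_cons n a (P : euclid R n.+1 -> R) (h : euclid R n -> R) :
  measurable_fun setT P -> measurable_fun setT h -> (forall x, 0 <= h x) ->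
  (forall x, 0 <= P x) ->
  (forall y x, P (tuple_cons (y, x)) = `|y| ^+ a * h x) ->
  gauss_integral P = (2%:E * G a * gauss_integral h)%E.
Proof.
move=> mP mh h0 P0 Ph.
have mg := @measurable_gauss_enorm R n.
have hg0 x : (0 <= (h x * gauss_fun (enorm x))%:E)%E.
  by rewrite lee_fin mulr_ge0 ?gauss_fun_ge0.
have yg0 (y : R) : 0 <= `|y| ^+ a * gauss_fun y.
  by rewrite mulr_ge0 ?exprn_ge0 ?gauss_fun_ge0.
rewrite /gauss_integral ge0_integral_cons; last 2 first.
- apply/measurable_EFinP; apply: measurable_funM => //; exact: measurable_gauss_enorm.
- by move=> x; rewrite lee_fin mulr_ge0 ?gauss_fun_ge0.
rewrite -gauss_momentE muleC -ge0_integralZl //; last 3 first.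
- apply/measurable_EFinP; apply: measurable_funM; last exact: measurable_gauss_fun.
  by apply: measurable_funX; exact: normr_measurable.
- by move=> y _; rewrite lee_fin.
- by apply: integral_ge0.
apply: eq_integral => y _; rewrite muleC -ge0_integralZl ?lee_fin //.
- apply: eq_integral => x _; rewrite Ph gauss_fun_enorm_cons -EFinM.
  by congr (_%:E); ring.
- by apply/measurable_EFinP; exact: measurable_funM.
Qed.

Definition gm (s : nat) : R := fine (G s).

Lemma half_gauss_moment_gm s : G s = (gm s)%:E.
Proof. by have [g _ e] := half_gauss_momentE R s; rewrite /gm e. Qed.

Lemma gm_gt0 s : 0 < gm s.
Proof. by have [g g0 e] := half_gauss_momentE R s; rewrite /gm e. Qed.

Lemma gmSS s : 2 * gm s.+2 = s.+1%:R * gm s.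
Proof. by have := half_gauss_momentSS R s; rewrite !half_gauss_moment_gm -!EFinM => -[]. Qed.

Lemma gauss_integral_cst1 n : exists2 w : R, 0 < w &
  gauss_integral (fun _ : euclid R n => 1) = w%:E.
Proof.
elim: n => [|n [w w0 wE]].
  exists (gauss_fun (enorm [tuple] : R)); first exact: expR_gt0.
  rewrite /gauss_integral.
  have -> : (\int[lebesgue_tuple 0]_x (1 * gauss_fun (enorm x))%:E =
     \int[dirac [tuple]]_x (1 * gauss_fun (enorm (x : euclid R 0)))%:E)%E by [].
  rewrite integral_dirac //; first by rewrite diracT mul1e mul1r.
  by apply/measurable_EFinP; apply: measurable_funM => //; exact: measurable_gauss_enorm.
exists (2 * gm 0 * w); first by rewrite !mulr_gt0 // gm_gt0.
rewrite (@gauss_integral_cons n 0 _ (fun=> 1)) // => [|y x]; last by rewrite mulr1.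
by rewrite wE half_gauss_moment_gm -!EFinM.
Qed.

Definition gvol n : R := fine (gauss_integral (fun _ : euclid R n => 1)).

Lemma gvol_gt0 n : 0 < gvol n.
Proof. by have [w w0 e] := gauss_integral_cst1 n; rewrite /gvol e. Qed.

Lemma gauss_integral_gvol n : gauss_integral (fun _ : euclid R n => 1) = (gvol n)%:E.
Proof. by have [w w0 e] := gauss_integral_cst1 n; rewrite /gvol e. Qed.

Definition abs_monomial n a b (x : euclid R n) : R := `|x`_0| ^+ a * `|x`_1| ^+ b.

Lemma measurable_abs_monomial n a b : measurable_fun setT (@abs_monomial n a b).
Proof.
by apply: measurable_funM; apply: measurable_funX; apply: measurableT_comp => //;
  exact: measurable_nth.
Qed.

Lemma abs_monomial_ge0 n a b x : 0 <= @abs_monomial n a b x.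
Proof. by rewrite mulr_ge0 ?exprn_ge0. Qed.

Lemma homogeneous_abs_monomial n a b : homogeneous (a + b) (@abs_monomial n a b).
Proof.
move=> t x t0; rewrite /abs_monomial !nth_dilate !normrM (gtr0_norm t0) !exprMn exprD.
by ring.
Qed.

Lemma gauss_integral_abs_monomial m a b :
  gauss_integral (@abs_monomial m.+2 a b) = (2 * gm a * (2 * gm b * gvol m))%:E.
Proof.
rewrite (@gauss_integral_cons m.+1 a _ (fun x => `|x`_0| ^+ b)).
- rewrite (@gauss_integral_cons m b _ (fun=> 1)).
  + by rewrite gauss_integral_gvol !half_gauss_moment_gm -!EFinM.
  + apply: measurable_funX; apply: measurableT_comp => //; exact: measurable_nth.
  + by [].
  + by [].
  + by move=> x; rewrite exprn_ge0.
  + by move=> y x; rewrite mulr1.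
- exact: measurable_abs_monomial.
- by apply: measurable_funX; apply: measurableT_comp => //; exact: measurable_nth.
- by move=> x; rewrite exprn_ge0.
- exact: abs_monomial_ge0.
- by [].
Qed.

(** Put q = a + b, n = m + 2, and write G for [gm R]. The surface integral is q + n times the ball
    integral and the Gaussian integral is 2 G(q+n+1) times it; as 2 G(q+n+1) = (q+n) G(q+n-1), the
    factor q + n cancels. *)
Lemma surface_abs_monomial m a b :
  (\int[surface_measure m.+2]_(v in unit_sphere R m.+2) (abs_monomial a b v)%:E =
   (4 * gm a * gm b * gvol m / gm (a + b + m).+1)%:E)%E.
Proof.
have vol0 := lebesgue_tuple_enorm0 m.+1.
have mP := @measurable_abs_monomial m.+2 a b.
have P0 := @abs_monomial_ge0 m.+2 a b.
have hP := @homogeneous_abs_monomial m.+2 a b.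
pose Q := abs_monomial a b \o @normalize R m.+2.
have mQ : measurable_fun setT Q := measurableT_comp mP (@measurable_normalize R m.+2).
have Q0 x : 0 <= Q x by exact: P0.
have hQ : homogeneous 0 Q by move=> t x t0; rewrite /Q /= normalize_dilate // mul1r.
have N0 : (0 <= ball_integral Q 1)%E.
  by apply: integral_ge0 => x _; rewrite lee_fin mulr_ge0.
(* Normalised coordinates are at most 1 in absolute value, so the Gaussian integral of [Q], a
   positive multiple of its ball integral, is finite. *)
have Nfin : (ball_integral Q 1 < +oo)%E.
  have : (gauss_integral Q <= (gvol m.+2)%:E)%E.
    rewrite -gauss_integral_gvol; apply: ge0_le_integral => //.
    - by move=> x _; rewrite lee_fin mulr_ge0 ?gauss_fun_ge0.
    - by apply/measurable_EFinP; apply: measurable_funM => //; exact: measurable_gauss_enorm.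
    - by apply/measurable_EFinP; apply: measurable_funM => //; exact: measurable_gauss_enorm.
    - move=> x _; rewrite lee_fin ler_wpM2r ?gauss_fun_ge0 //.
      have nx i : `|(normalize x)`_i| <= 1.
        rewrite nth_normalize normrM normfV (ger0_norm (enorm_ge0 x)).
        have [->|x0] := eqVneq (enorm x) 0; first by rewrite invr0 mulr0.
        by rewrite ler_pdivrMr ?mul1r ?nth_le_enorm // lt_neqAle eq_sym x0 enorm_ge0.
      by rewrite /Q /= /abs_monomial mulr_ile1 ?exprn_ge0 ?exprn_ile1.
  rewrite (@gauss_integralE _ _ 0) // half_gauss_moment_gm -EFinM.
  move: N0; case: (ball_integral Q 1) => [r| |] // _.
    by rewrite ltry.
  by rewrite gt0_muley // lte_fin mulr_gt0 // gm_gt0.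
rewrite ge0_integral_surface // (@ball_integral_normalize _ _ (a + b)) //.
have := gauss_integral_abs_monomial m a b.
rewrite (@gauss_integralE _ _ (a + b)) // half_gauss_moment_gm -EFinM.
have p0 : 0 < 2 * gm (a + b + m.+2).+1 by rewrite mulr_gt0 // gm_gt0.
have A0 : (0 <= ball_integral (@abs_monomial m.+2 a b) 1)%E.
  by apply: integral_ge0 => x _; rewrite lee_fin mulr_ge0.
move: A0; case: (ball_integral _ 1) => [r| |] // _; last by rewrite gt0_muley.
rewrite -EFinM => -[rE]; rewrite -EFinM; congr (_%:E).
have gE := gmSS (a + b + m).+1.
rewrite !addnS in rE p0 *; rewrite gE in rE p0.
have g0 := gm_gt0 (a + b + m).+1.
apply: (@mulIf _ (gm (a + b + m).+1)); first by rewrite gt_eqF.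
by rewrite divfK ?gt_eqF // mulrAC rE; ring.
Qed.
End product_moments.

(** * Sign changes of coordinates and odd functions *)

Section reflection.
Variables (R : realType) (n : nat).
Local Notation E := (euclid R n).
Local Notation sigma := (@surface_measure R n).
Local Notation S := (unit_sphere R n).

Lemma enorm_sign_scale (c : n.-tuple R) (x : E) :
  (forall i, tnth c i ^+ 2 = 1) -> enorm (tuple_scale c x) = enorm x.
Proof.
move=> c1; rewrite /enorm; congr Num.sqrt; apply: eq_bigr => i _.
by rewrite tnth_mktuple exprMn c1 mul1r.
Qed.

Lemma ge0_integral_surface_sign (c : n.-tuple R) (f : E -> R) :
  (forall i, tnth c i ^+ 2 = 1) -> measurable_fun setT f -> (forall x, 0 <= f x) ->
  (\int[sigma]_(v in S) (f (tuple_scale c v))%:E = \int[sigma]_(v in S) (f v)%:E)%E.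
Proof.
move=> c1 mf f0.
have mc := measurable_tuple_scale c.
have c0 i : tnth c i != 0 by rewrite -sqrf_eq0 c1 oner_neq0.
rewrite !ge0_integral_surface //; last exact: measurableT_comp mf mc.
congr (_ * _)%E; rewrite /ball_integral.
rewrite -[RHS](@ge0_integral_tuple_scale _ _ c) //; last 2 first.
- apply/measurable_EFinP; apply: measurable_funM; last exact: measurable_in_ball.
  exact: measurableT_comp mf (@measurable_normalize R n).
- by move=> x; rewrite lee_fin mulr_ge0 //=.
rewrite big1 ?mul1e => [|i _]; last first.
  by apply/eqP; rewrite -sqrp_eq1 ?normr_ge0 // real_normK ?num_real // c1.
apply: eq_integral => x _; rewrite enorm_sign_scale //= ; congr ((f _ * _)%:E).
apply: eq_from_tnth => i; rewrite !tnth_mktuple enorm_sign_scale //.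
by rewrite mulrA.
Qed.

(** The sign change exchanges the positive and negative parts of [f]; integrability makes their
    difference 0 instead of an indeterminate form. *)
Lemma integral_surface_odd (c : n.-tuple R) (f : E -> R) :
  (forall i, tnth c i ^+ 2 = 1) -> sigma.-integrable S (EFin \o f) ->
  measurable_fun setT f -> (forall x, f (tuple_scale c x) = - f x) ->
  \int[sigma]_(v in S) f v = 0.
Proof.
move=> c1 intf mf fodd; rewrite /Rintegral integralE.
have -> : (\int[sigma]_(v in S) (fun v => (f v)%:E)^\- v =
           \int[sigma]_(v in S) (fun v => (f v)%:E)^\+ v)%E.
  transitivity (\int[sigma]_(v in S) (Num.max (f (tuple_scale c v)) 0)%:E)%E.
    by apply: eq_integral => v _; rewrite funenegE fodd -EFinN -EFin_max.
  rewrite (@ge0_integral_surface_sign c (fun v => Num.max (f v) 0)) //.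
  - by apply: eq_integral => v _; rewrite funeposE EFin_max.
  - exact: measurable_maxr mf (measurable_cst _).
  - by move=> x; rewrite le_max lexx orbT.
have mS := @measurable_unit_sphere R n.
by rewrite subee //; apply: integrable_fin_num => //; exact: integrable_funepos.
Qed.
End reflection.

Lemma normX_even (R : realDomainType) (x : R) a : ~~ odd a -> `|x| ^+ a = x ^+ a.
Proof.
by move=> ea; rewrite -[a]odd_double_half (negbTE ea) -mul2n !exprM real_normK ?num_real.
Qed.

(** * Signed moments in the first two coordinates *)

Section sphere_moments.
Variables (R : realType) (m : nat).
Local Notation n := m.+2.
Local Notation E := (euclid R n).
Local Notation sigma := (@surface_measure R n).
Local Notation S := (unit_sphere R n).

Lemma integrable_monomial a b :
  sigma.-integrable S (EFin \o (fun v : E => v`_0 ^+ a * v`_1 ^+ b)).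
Proof.
apply/integrableP; split.
  apply/measurable_EFinP; apply: measurable_funTS.
  by apply: measurable_funM; apply: measurable_funX; exact: measurable_nth.
rewrite (_ : (fun x => _) = fun v : E => (abs_monomial a b v)%:E).
  by rewrite surface_abs_monomial ltry.
by apply/funext => v /=; rewrite normrM !normrX.
Qed.

Definition sphere_moment a b : R := \int[sigma]_(v in S) (v`_0 ^+ a * v`_1 ^+ b).

Lemma sphere_moment_even a b : ~~ odd a -> ~~ odd b ->
  sphere_moment a b = 4 * gm R a * gm R b * gvol R m / gm R (a + b + m).+1.
Proof.
move=> ea eb; rewrite /sphere_moment /Rintegral.
rewrite (_ : (\int[sigma]_(v in S) _ = \int[sigma]_(v in S) (abs_monomial a b v)%:E)%E).
  by rewrite surface_abs_monomial.
by apply: eq_integral => v _; rewrite /abs_monomial !normX_even.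
Qed.

Lemma sphere_moment_odd a b : odd a || odd b -> sphere_moment a b = 0.
Proof.
move=> odd_ab.
(* The reflected coordinate is one with odd exponent: the first if [a] is odd, otherwise the
   second. *)
pose c : n.-tuple R :=
  [tuple (if (if odd a then i == 0 :> nat else i == 1 :> nat) then -1 else 1) | i < n].
have nthc (v : E) i : (i < n)%N -> (tuple_scale c v)`_i =
    (if (if odd a then i == 0 else i == 1)%N then -1 else 1) * v`_i.
  move=> ni; have nthE (y : E) : y`_i = tnth y (Ordinal ni) by rewrite (tnth_nth 0).
  by rewrite !nthE tnth_mktuple tnth_mktuple.
apply: (@integral_surface_odd _ _ c).
- by move=> i; rewrite tnth_mktuple; case: ifP => _; rewrite ?sqrrN expr1n.
- exact: integrable_monomial.
- by apply: measurable_funM; apply: measurable_funX; exact: measurable_nth.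
- move=> v; rewrite !nthc //.
  move: odd_ab; have [oa _|ea /= ob] := boolP (odd a); rewrite mul1r ?mulN1r.
    by rewrite exprNn -signr_odd oa expr1 mulN1r mulNr.
  by rewrite exprNn -signr_odd ob expr1 mulN1r mulrN.
Qed.

(** For even exponents numerator and denominator both move by two, and [gmSS] supplies the factors b
    + 1 and a + b + n. *)
Lemma sphere_momentSS_r a b :
  (a + b + n)%:R * sphere_moment a b.+2 = b.+1%:R * sphere_moment a b.
Proof.
have [oab|] := boolP (odd a || odd b).
  by rewrite !sphere_moment_odd ?mulr0 //= negbK.
rewrite negb_or => /andP[ea eb].
rewrite !sphere_moment_even //= ?negbK //.
have gE s : gm R s.+2 = s.+1%:R * gm R s / 2 by rewrite -gmSS mulrC mulKf.
rewrite !(addnS, addSn) !gE.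
have q0 : gm R (a + b + m).+1 != 0 by rewrite gt_eqF // gm_gt0.
have r0 : (a + b + m).+2%:R != 0 :> R by rewrite pnatr_eq0.
move: (gm R _) q0 (_%:R) r0 (b.+1%:R) => x x0 y y0 z.
by field; rewrite x0 y0.
Qed.

Lemma sphere_momentSS_l a b :
  (a + b + n)%:R * sphere_moment a.+2 b = a.+1%:R * sphere_moment a b.
Proof.
case: (boolP (odd a || odd b)) => [oab|].
  by rewrite !sphere_moment_odd ?mulr0 //= negbK.
rewrite negb_or => /andP[ea eb].
rewrite !sphere_moment_even //= ?negbK //.
have gE s : gm R s.+2 = s.+1%:R * gm R s / 2 by rewrite -gmSS mulrC mulKf.
rewrite !(addnS, addSn) !gE.
have q0 : gm R (a + b + m).+1 != 0 by rewrite gt_eqF // gm_gt0.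
have r0 : (a + b + m).+2%:R != 0 :> R by rewrite pnatr_eq0.
move: (gm R (_.+1)) q0 (_.+2%:R) r0 (a.+1%:R) => x x0 y y0 z.
by field; rewrite x0 y0.
Qed.

Lemma sphere_moment00_gt0 : 0 < sphere_moment 0 0.
Proof.
by rewrite sphere_moment_even // divr_gt0 ?gm_gt0 // !mulr_gt0 ?gm_gt0 ?gvol_gt0.
Qed.

End sphere_moments.

Local Open Scope complex_scope.

(** * Recurrences for the eigenvalues *)

Section complex_integral.
Context d (T : measurableType d) (R : realType) (mu : {measure set T -> \bar R}).
Variables (D : set T) (mD : measurable D).
Implicit Types F G : T -> R[i].

Definition Cintegrable F :=
  mu.-integrable D (EFin \o (fun x => complex.Re (F x))) /\
  mu.-integrable D (EFin \o (fun x => complex.Im (F x))).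

Lemma eq_Cintegral F G : F =1 G -> Cintegral mu D F = Cintegral mu D G.
Proof. by move=> /funext ->. Qed.

Lemma CintegrableD F G : Cintegrable F -> Cintegrable G ->
  Cintegrable (fun x => F x + G x).
Proof.
move=> [rF iF] [rG iG]; split.
  rewrite (_ : _ \o _ = (EFin \o (fun x => complex.Re (F x))) \+
    (EFin \o (fun x => complex.Re (G x))))%E.
    exact: integrableD.
  by apply/funext => x /=; rewrite raddfD.
rewrite (_ : _ \o _ = (EFin \o (fun x => complex.Im (F x))) \+
    (EFin \o (fun x => complex.Im (G x))))%E.
  exact: integrableD.
by apply/funext => x /=; rewrite raddfD.
Qed.

Lemma CintegralD F G : Cintegrable F -> Cintegrable G ->
  Cintegral mu D (fun x => F x + G x) = Cintegral mu D F + Cintegral mu D G.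
Proof.
move=> [rF iF] [rG iG]; rewrite /Cintegral.
under eq_Rintegral do rewrite raddfD.
under [X in _ +i* X]eq_Rintegral do rewrite raddfD.
by rewrite !RintegralD.
Qed.

Lemma complex_ReM (x y : R[i]) : complex.Re (x * y) =
  complex.Re x * complex.Re y - complex.Im x * complex.Im y.
Proof. by case: x y => [a b] [a' b']. Qed.

Lemma complex_ImM (x y : R[i]) : complex.Im (x * y) =
  complex.Re x * complex.Im y + complex.Im x * complex.Re y.
Proof. by case: x y => [a b] [a' b']. Qed.

Lemma CintegrableZ c F : Cintegrable F -> Cintegrable (fun x => c * F x).
Proof.
move=> [rF iF]; split.
  rewrite (_ : _ \o _ = (fun x => (complex.Re c)%:E * (complex.Re (F x))%:E -
    (complex.Im c)%:E * (complex.Im (F x))%:E)%E).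
    by apply: integrableB => //; exact: integrableZl.
  by apply/funext => x /=; rewrite complex_ReM EFinB.
rewrite (_ : _ \o _ = (fun x => (complex.Re c)%:E * (complex.Im (F x))%:E +
    (complex.Im c)%:E * (complex.Re (F x))%:E)%E).
  by apply: integrableD => //; exact: integrableZl.
by apply/funext => x /=; rewrite complex_ImM EFinD.
Qed.

Lemma CintegralZ c F : Cintegrable F ->
  Cintegral mu D (fun x => c * F x) = c * Cintegral mu D F.
Proof.
move=> [rF iF]; rewrite /Cintegral.
under eq_Rintegral do rewrite complex_ReM.
under [X in _ +i* X]eq_Rintegral do rewrite complex_ImM.
have zl r (f : T -> R) : mu.-integrable D (EFin \o f) ->
   mu.-integrable D (EFin \o (fun x => r * f x)).
  move=> intf; rewrite (_ : EFin \o _ = fun x => (r%:E * (EFin \o f) x)%E); last first.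
    by apply/funext => x /=; rewrite EFinM.
  exact: integrableZl.
rewrite RintegralB ?RintegralD ?RintegralZl //; try exact: zl.
by case: c => a b.
Qed.

Lemma Cintegrable_real (f : T -> R) : mu.-integrable D (EFin \o f) ->
  Cintegrable (fun x => (f x)%:C).
Proof. by move=> intf; split => //; exact: integrable0. Qed.

Lemma Cintegral_real (f : T -> R) :
  Cintegral mu D (fun x => (f x)%:C) = (\int[mu]_(x in D) f x)%:C.
Proof. by rewrite /Cintegral /= /Rintegral integral0. Qed.

End complex_integral.

(** * Polynomial algebra behind the two integrations by parts *)

Lemma bipoly_ind (K : comRingType) (Z : {poly {poly K}} -> Prop) :
  Z 0 -> (forall p q, Z p -> Z q -> Z (p + q)) ->
  (forall c a b, Z (c%:P%:P * (('X^a)%:P * 'X^b))) -> forall p, Z p.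
Proof.
move=> Z0 ZD Zm p; rewrite -[p]coefK poly_def.
apply: (big_ind Z) => // b _; rewrite -[p`_b]coefK poly_def scaler_suml.
apply: (big_ind Z) => // a _.
by rewrite -!mul_polyC polyCM -mulrA.
Qed.

Lemma derivM_const (K : comRingType) (p q : {poly K}) :
  p^`() = 0 -> (p * q)^`() = p * q^`().
Proof. by move=> p0; rewrite derivM p0 mul0r add0r. Qed.

(** Read [a] as i x, [h] as 1 - x^2 and [o] as h + i x y; the left side holds the y-derivative of a
    h^k o^l. The factor [a] is there because a^2 (1 - x^2 - y^2) = 2 h o - h - o^2 involves [h] and
    [o] only, so that integrands of the same family come back. *)
Lemma dy_identity (K : comRingType) (k l : nat) (a y h o : K) :
  a ^+ 2 = h - 1 -> a * y = o - h ->
  (1 - (1 - h) - y ^+ 2) * (a * (h ^+ k * (a * o ^+ l.-1 *+ l))) =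
  l%:R * (2%:R * (h ^+ k.+1 * o ^+ l) - h ^+ k.+1 * o ^+ l.-1 - h ^+ k * o ^+ l.+1).
Proof.
move=> a2 ay; case: l => [|l]; first by rewrite mulr0n !mulr0 mul0r.
transitivity (l.+1%:R * (h ^+ k * o ^+ l) * (a ^+ 2 * h - (a * y) ^+ 2)).
  by rewrite -mulr_natl /=; ring.
by rewrite a2 ay /= !exprS; ring.
Qed.

(** Read [u] as 1 - x^2; the left side is [u] times the derivative of x u^k. *)
Lemma dx_identity (K : comRingType) (k : nat) (x u : K) : x * x = 1 - u ->
  u * (u ^+ k + x * (- (2%:R * x) * u ^+ k.-1 *+ k)) =
  (2 * k + 1)%:R * u ^+ k.+1 - (2 * k)%:R * u ^+ k.
Proof.
move=> xx; case: k => [|k]; first by rewrite mulr0n !expr0; ring.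
transitivity (u ^+ k.+2 - (2 * k.+1)%:R * (x * x) * u ^+ k.+1).
  by rewrite natrM -mulr_natl /= !exprS; ring.
by rewrite xx natrD !exprS; ring.
Qed.

Lemma dy_identity_rhs (K : comRingType) (k l : nat) (a y h o : K) :
  a * y = o - h ->
  y * (a * (h ^+ k * o ^+ l)) = h ^+ k * o ^+ l.+1 - h ^+ k.+1 * o ^+ l.
Proof. by move=> ay; rewrite mulrA (mulrC y) ay !exprS; ring. Qed.

(** * The sphere integral as a linear functional on polynomials in two variables *)

Section sphere_functional.
Variables (R : realType) (m : nat).
Local Notation n := m.+2.
Local Notation C := R[i].
Local Notation E := (euclid R n).
Local Notation sigma := (@surface_measure R n).
Local Notation S := (unit_sphere R n).
Implicit Types p q : {poly {poly C}}.

(* The inner variable stands for the first coordinate, the outer one for the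
   second. *)
Definition eval12 p (v : E) : C := p.[(v`_1)%:C%:P].[(v`_0)%:C].

Definition sphere_int p : C := Cintegral sigma S (eval12 p).

Lemma eval12_monomial c a b v :
  eval12 (c%:P%:P * (('X^a)%:P * 'X^b)) v = c * (v`_0 ^+ a * v`_1 ^+ b)%:C.
Proof. by rewrite /eval12 !hornerE !rmorphM !rmorphXn /= !hornerE. Qed.

Lemma Cintegrable_eval12 p : Cintegrable sigma S (eval12 p).
Proof.
have mS := @measurable_unit_sphere R n.
elim/bipoly_ind: p => [|p q ip iq|c a b].
- rewrite (_ : eval12 0 = fun=> 0); first by split; exact: integrable0.
  by apply/funext => v; rewrite /eval12 !hornerE.
- rewrite (_ : eval12 _ = fun v => eval12 p v + eval12 q v); first exact: CintegrableD.
  by apply/funext => v; rewrite /eval12 !hornerE.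
- rewrite (_ : eval12 _ = fun v => c * (v`_0 ^+ a * v`_1 ^+ b)%:C).
    by apply: CintegrableZ => //; apply: Cintegrable_real => //; exact: integrable_monomial.
  by apply/funext => v; rewrite eval12_monomial.
Qed.

Lemma sphere_intD p q : sphere_int (p + q) = sphere_int p + sphere_int q.
Proof.
rewrite /sphere_int -CintegralD //; try exact: Cintegrable_eval12.
  by apply: eq_Cintegral => v; rewrite /eval12 !hornerE.
exact: measurable_unit_sphere.
Qed.

Lemma sphere_intZ c p : sphere_int (c%:P%:P * p) = c * sphere_int p.
Proof.
rewrite /sphere_int -CintegralZ //; try exact: Cintegrable_eval12.
  by apply: eq_Cintegral => v; rewrite /eval12 !hornerE.
exact: measurable_unit_sphere.
Qed.

Lemma sphere_int_nat k p : sphere_int (k%:R * p) = k%:R * sphere_int p.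
Proof. by rewrite -sphere_intZ !rmorph_nat. Qed.

Lemma sphere_intB p q : sphere_int (p - q) = sphere_int p - sphere_int q.
Proof.
rewrite sphere_intD; congr (_ + _).
by rewrite -mulN1r -[RHS]mulN1r -sphere_intZ !rmorphN !rmorph1.
Qed.

Lemma sphere_int0 : sphere_int 0 = 0.
Proof. by rewrite -(subrr 0) sphere_intB subrr. Qed.

Lemma sphere_int_monomial a b :
  sphere_int (('X^a)%:P * 'X^b) = (sphere_moment R m a b)%:C.
Proof.
rewrite /sphere_int -Cintegral_real; apply: eq_Cintegral => v.
by rewrite -[RHS]mul1r -eval12_monomial !rmorph1 mul1r.
Qed.

(* The divergence theorem on the disc, for the weight [(1 - x^2 - y^2)^(m/2 - 1)]
   of the projection of the surface measure to the first two coordinates *)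
Lemma sphere_int_dy p :
  sphere_int ((1 - ('X^2)%:P - 'X^2) * p^`()) = m%:R * sphere_int ('X * p).
Proof.
elim/bipoly_ind: p => [|p q ip iq|c a b].
- by rewrite deriv0 !mulr0 sphere_int0 mulr0.
- by rewrite derivD !mulrDr !sphere_intD ip iq mulrDr.
have dE : (c%:P%:P * (('X^a)%:P * 'X^b))^`() =
    c%:P%:P * (('X^a)%:P * ('X^(b.-1) *+ b)) :> {poly {poly C}}.
  by rewrite !mul_polyC !derivZ derivXn.
rewrite {}dE [LHS](congr1 sphere_int (mulrCA _ _ _)) sphere_intZ.
rewrite (mulrCA 'X) (mulrCA 'X) -exprS sphere_intZ [RHS]mulrCA; congr (_ * _).
rewrite (sphere_int_monomial a b.+1).
case: b => [|b].
  by rewrite sphere_moment_odd ?orbT // !mulr0n !mulr0 sphere_int0.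
pose M i j : {poly {poly C}} := ('X^i)%:P * 'X^j.
rewrite [X in sphere_int X](_ : _ = b.+1%:R * (M a b - M a.+2 b - M a b.+2)); last first.
  rewrite /M -mulr_natl /= -[a.+2](addn2 a) -[b.+2](addn2 b) !exprD polyCM.
  by ring.
rewrite sphere_int_nat !sphere_intB !sphere_int_monomial -!rmorphB /=.
rewrite -!(rmorph_nat (real_complex R)) -!rmorphM; congr (_%:C).
have := sphere_momentSS_r R m a b; have := sphere_momentSS_l R m a b.
have : (a + b + n)%:R != 0 :> R by rewrite pnatr_eq0 !addnS.
move: (sphere_moment R m a b) (sphere_moment R m a.+2 b) (sphere_moment R m a b.+2) => x y z.
rewrite -(addn2 m) -(addn1 a) -(addn1 b) !natrD.
move: (a%:R) (b%:R) (m%:R) => u v w N0 hl hr.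
by apply: (mulfI N0); rewrite mulrCA [RHS]mulrCA hr !mulrBr hl hr; ring.
Qed.

(** The one-variable analogue, for the density (1 - x^2)^((m-1)/2) of the first coordinate. It is
    needed because [eigS] does not relate the values [eig k 0] to one another. *)
Lemma sphere_int_dx (q : {poly C}) :
  sphere_int (((1 - 'X^2) * q^`())%:P) = m.+1%:R * sphere_int (('X * q)%:P).
Proof.
rewrite -[q]coefK poly_def; apply: (big_ind (fun q : {poly C} =>
  sphere_int (((1 - 'X^2) * q^`())%:P) = m.+1%:R * sphere_int (('X * q)%:P))).
- by rewrite deriv0 !mulr0 !rmorph0 sphere_int0 mulr0.
- by move=> r s hr hs; rewrite derivD !mulrDr !polyCD !sphere_intD hr hs mulrDr.
move=> i _; have -> : q`_i *: 'X^i = (q`_i)%:P * 'X^i :> {poly C} by rewrite mul_polyC.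
suff H c j : sphere_int (((1 - 'X^2) * (c%:P * 'X^j)^`())%:P) =
  m.+1%:R * sphere_int (('X * (c%:P * 'X^j))%:P) by exact: H.
have -> : (c%:P * 'X^j)^`() = c%:P * ('X^(j.-1) *+ j) :> {poly C}.
  by rewrite !mul_polyC !derivZ derivXn.
pose M i : {poly {poly C}} := ('X^i)%:P * 'X^0.
have -> : ('X * (c%:P * 'X^j))%:P = c%:P%:P * M j.+1.
  by rewrite /M expr0 mulr1 mulrCA -exprS polyCM.
rewrite sphere_intZ sphere_int_monomial [RHS]mulrCA.
case: j => [|j].
  by rewrite mulr0n !mulr0 rmorph0 sphere_int0 sphere_moment_odd // !mulr0.
rewrite [X in sphere_int X](_ : _ = c%:P%:P * (j.+1%:R * (M j - M j.+2))); last first.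
  rewrite /M !expr0 !mulr1 -polyCB -(rmorph_nat polyC) -!polyCM; congr (_%:P).
  by rewrite -mulr_natl /= -[j.+2](addn2 j) exprD; ring.
rewrite sphere_intZ sphere_int_nat sphere_intB !sphere_int_monomial; congr (_ * _).
rewrite -!rmorphB /= -!(rmorph_nat (real_complex R)) -!rmorphM; congr (_%:C).
have := sphere_momentSS_l R m j 0.
rewrite addn0 -(addn2 m) -(addn1 m) -(addn1 j) !natrD.
by move: (sphere_moment R m j 0) (sphere_moment R m _ 0) => x y h; rewrite mulrBr -h; ring.
Qed.

Definition horizontal : {poly {poly C}} := (1 - 'X^2)%:P.
Definition oscillating : {poly {poly C}} := horizontal + ('i *: 'X)%:P * 'X.
Definition eig k l : C := sphere_int (horizontal ^+ k * oscillating ^+ l).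

(** The rule [sphere_int_dy] for the test polynomial i x h^k o^l. *)
Lemma eigS k l : (l + m)%:R * eig k l.+1 =
  (2 * l + m)%:R * eig k.+1 l - l%:R * eig k.+1 l.-1.
Proof.
pose A : {poly {poly C}} := ('i *: 'X)%:P.
have A2 : A ^+ 2 = horizontal - 1.
  rewrite /A /horizontal -polyC_exp exprZn sqr_i scaleN1r -polyC1 -polyCB.
  by congr (_%:P); ring.
have dosc : oscillating^`() = A.
  rewrite /oscillating /horizontal derivD derivC add0r mul_polyC derivZ derivX.
  by rewrite -mul_polyC mulr1.
have dhk : (horizontal ^+ k)^`() = 0 by rewrite /horizontal -polyC_exp derivC.
have dA : A^`() = 0 by rewrite derivC.
have := sphere_int_dy (A * (horizontal ^+ k * oscillating ^+ l)).
rewrite (derivM_const _ dA) (derivM_const _ dhk) deriv_exp dosc.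
have oE : A * 'X = oscillating - horizontal by rewrite /oscillating addrC addKr.
have hE : ('X^2)%:P = 1 - horizontal :> {poly {poly C}}.
  by rewrite /horizontal polyCB polyC1 opprB addrC subrK.
rewrite hE (dy_identity k l A2 oE) (dy_identity_rhs k l oE).
rewrite sphere_int_nat !sphere_intB sphere_int_nat -!/(eig _ _).
rewrite (natrD _ l) (natrD _ (2 * l)) natrM.
move: (eig _ _) (eig _ _) (eig _ _) => x y z e.
transitivity (m%:R * (x - z) + m%:R * z + l%:R * x); first by ring.
by rewrite -e; ring.
Qed.

Lemma eigS0 k : (2 * k + m + 2)%:R * eig k.+1 0 = (2 * k + m + 1)%:R * eig k 0.
Proof.
pose U : {poly C} := 1 - 'X^2.
have eigE j : eig j 0 = sphere_int ((U ^+ j)%:P).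
  by rewrite /eig expr0 mulr1 /horizontal -polyC_exp.
have := sphere_int_dx ('X * U ^+ k).
have dU : U^`() = - (2%:R * 'X) by rewrite derivB derivC sub0r derivXn /= expr1 -mulr_natl.
have XX : 'X * 'X = 1 - U :> {poly C} by rewrite /U opprB addrC subrK expr2.
rewrite derivM derivX mul1r deriv_exp dU (dx_identity k XX) mulrA XX.
have -> : (1 - U) * U ^+ k = U ^+ k - U ^+ k.+1 by rewrite exprS; ring.
rewrite !polyCB !rmorphM !rmorph_nat sphere_intB !sphere_int_nat sphere_intB -!eigE.
rewrite -(natr1 m) !(natrD _ (2 * k + m)) !(natrD _ (2 * k)) natrM.
move: (eig _ _) (eig _ _) => x y e.
transitivity ((2 * k%:R + 1) * y - 2 * k%:R * x + 2 * k%:R * x + (m%:R + 1) * y).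
  by ring.
by rewrite e; ring.
Qed.

Lemma eig00 : eig 0 0 = (sphere_moment R m 0 0)%:C.
Proof. by rewrite -sphere_int_monomial /eig !expr0 polyC1. Qed.

Lemma lambda_eig k l : lambda R n k l = (Num.sqrt pi)%:C * eig k l.
Proof.
rewrite /lambda /eig /sphere_int; congr (_ * _); apply: eq_Cintegral => v.
by rewrite /eval12 /horizontal /oscillating !hornerE.
Qed.

End sphere_functional.

(** The recurrences have real coefficients, so uniqueness applies to real and imaginary parts
    separately; the latter vanish since [eig 0 0] is real. *)
Lemma eig_gseq (R : realType) (m k l : nat) : (0 < m)%N ->
  eig R m k l = (sphere_moment R m 0 0 * gseq (m%:R / 2) k l)%:C.
Proof.
move=> m0; have al0 : 0 < m%:R / 2 :> R by rewrite divr_gt0 // ltr0n.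
have alm : 2 * (m%:R / 2) = m%:R :> R by rewrite mulrC divfK.
have H (f : R[i] -> R) : {morph f : x y / x - y} ->
    (forall j x, f (j%:R * x) = j%:R * f x) ->
    f (eig R m k l) = f (eig R m 0 0) * gseq (m%:R / 2) k l.
  move=> fB fN.
  apply: (gseq_unique al0 (Y := fun k l => f (eig R m k l))) => [{}k|{}k {}l].
    have := congr1 f (eigS0 R m k); rewrite !fN alm.
    by rewrite !(natrD _ (2 * k + m)) !(natrD _ (2 * k)) natrM.
  have := congr1 f (eigS R m k l); rewrite fB !fN.
  by rewrite (natrD _ l) (natrD _ (2 * l)) natrM mulrDr alm.
have ReN j (x : R[i]) : complex.Re (j%:R * x) = j%:R * complex.Re x.
  by rewrite -(rmorph_nat (real_complex R)) complex_ReM /= mul0r subr0.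
have ImN j (x : R[i]) : complex.Im (j%:R * x) = j%:R * complex.Im x.
  by rewrite -(rmorph_nat (real_complex R)) complex_ImM /= mul0r addr0.
have ReB : {morph @complex.Re R : x y / x - y} by move=> [? ?] [? ?].
have ImB : {morph @complex.Im R : x y / x - y} by move=> [? ?] [? ?].
move: (H _ ReB ReN) (H _ ImB ImN).
by rewrite eig00; case: (eig R m k l) => a b /= -> ->; rewrite mul0r.
Qed.

Lemma Lambda_Lam (R : realType) (m k l : nat) :
  Lambda R m.+2 k l = Lam (m%:R / 2) k l.
Proof.
have alm : 2 * (m%:R / 2) = m%:R :> R by rewrite mulrC divfK.
by rewrite LambdaE /Lam alm -(addn2 m) natrD; ring.
Qed.

(* The order of [R[i]] is the one for which [x <= y] says that [x] and [y] have
   equal imaginary parts and [Re x <= Re y]; in particular the inequalities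
   below contain the claim that [lambda R d k l] is real. *)
Theorem theorem1p4 (R : realType) (d : nat) (hd : (3 <= d)%N) :
  exists c C : R, [/\ 0 < c, 0 < C &
    forall k l : nat,
      (c * Lambda R d k l `^ (- 2^-1))%:C <= lambda R d k l /\
      lambda R d k l <= (C * Lambda R d k l `^ (- 2^-1))%:C].
Proof.
case: d hd => [|[|[|m]]] // _.
set al : R := m.+1%:R / 2.
have al0 : 0 < al by rewrite divr_gt0 // ltr0n.
(* The first case is d = 3, the second d >= 4. *)
have alP : al = 2^-1 \/ 1 <= al.
  rewrite /al; case: (m) => [|j]; first by left; rewrite mul1r.
  by right; rewrite ler_pdivlMr // mul1r ler_nat.
have [C0 C0_gt0 upper] := gseq_sqr_upper alP.
have [c0 c0_gt0 lower] := gseq_sqr_lower alP.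
pose M := Num.sqrt pi * sphere_moment R m.+1 0 0.
have M0 : 0 < M by rewrite mulr_gt0 ?sqrtr_gt0 ?pi_gt0 // sphere_moment00_gt0.
exists (M * Num.sqrt c0), (M * Num.sqrt C0).
split=> [||k l]; [by rewrite mulr_gt0 ?sqrtr_gt0|by rewrite mulr_gt0 ?sqrtr_gt0|].
have L0 : 0 < Lambda R m.+3 k l.
  by rewrite LambdaE ltr_wpDl ?ltr0n // !addr_ge0 ?mulr_ge0 ?sqr_ge0.
rewrite lambda_eig eig_gseq // -rmorphM mulrA -/M -/al !lecR.
have X0 := gseq_gt0 al0 k l.
have -> : Lambda R m.+3 k l `^ (- 2^-1) = (Num.sqrt (Lambda R m.+3 k l))^-1.
  by rewrite powRN powR12_sqrt // ltW.
have sL0 : 0 < Num.sqrt (Lambda R m.+3 k l) by rewrite sqrtr_gt0.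
(* Both inequalities become square roots of the bounds on [gseq] squared times [Lam]. *)
have XE : gseq al k l = Num.sqrt (gseq al k l ^+ 2) by rewrite sqrtr_sqr gtr0_norm.
rewrite -!(mulrA M) !(ler_pM2l M0) ler_pdivrMr // ler_pdivlMr // XE -!sqrtrM ?sqr_ge0 //.
by rewrite Lambda_Lam !ler_wsqrtr.
Qed.
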